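(* For every $\varepsilon>0$ there is a constant $C_\varepsilon>0$ such that for all $m,n\in\mathbb{N}$ $$f_4(m,n)\le C_\varepsilon\, n^{\varepsilon}\min\left\{\frac{n^{3/2}}{m^{3/4}},\ \frac{n^{8/5}}{m},\ \left(\frac{n^{4/3}}{m^{2/3}}+\frac{n^{28/17}}{m^{8/5}}\right),\ \left(\Big(\frac{n}{m}\Big)^{5/3}+\frac{n^{4/3}}{m^{2/3}}\right)\right\}.$$
   Context: $\mathbb{N}$ denotes the positive integers. For $k,m,n\in\mathbb{N}$, $$f_k(m,n)=\left|\left\{(a_1,\ldots,a_k)\in\mathbb{N}^k:\ a_1\le\cdots\le a_k,\ \frac{m}{n}=\sum_{i=1}^k\frac1{a_i}\right\}\right|.$$ *)

(* Defs.v *)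
From HB Require Import structures.
From mathcomp Require Import all_boot all_order all_algebra.
From mathcomp Require Import finmap.
From mathcomp Require Import all_classical all_reals all_analysis.

Set Implicit Arguments.
Unset Strict Implicit.
Unset Printing Implicit Defensive.

Import Order.TTheory GRing.Theory Num.Theory.

Local Open Scope classical_set_scope.
Local Open Scope ring_scope.

(* [nat] contains 0, so positivity of the denominators is required explicitly. *)
Definition unit_fraction_reps (k m n : nat) : set (k.-tuple nat) :=
  [set a : k.-tuple nat | [/\ all (fun x => (0 < x)%N) a,
               sorted leq a &
               m%:R / n%:R = \sum_(i < k) (tnth a i)%:R^-1 :> rat]].

Arguments unit_fraction_reps : clear implicits.

(* [fset_set] sends infinite sets to the empty set; by
   [finite_unit_fraction_reps] below this never occurs. *)
Definition egyptian_count (k m n : nat) : nat := #|` fset_set (unit_fraction_reps k m n)|.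

Lemma finite_unit_fraction_seqs (k : nat) (q : rat) :
  finite_set [set s : seq nat | [/\ size s = k, all (fun x => (0 < x)%N) s,
    sorted leq s & q = \sum_(x <- s) x%:R^-1]].
Proof.
elim: k q => [|k IH] q.
  by apply: (@sub_finite_set _ _ [set [::]]) => // -[|x s] [].
pose N := (Num.bound (k.+1%:R / q)).+1.
apply: (@sub_finite_set _ _ (\bigcup_(a in `I_N)
  (cons a @` [set s : seq nat | [/\ size s = k, all (fun x => (0 < x)%N) s,
    sorted leq s & q - a%:R^-1 = \sum_(x <- s) x%:R^-1]]))); last first.
  apply: bigcup_finite; first exact: finite_II.
  by move=> a _; apply: finite_image; exact: IH.
move=> [|a s] [] //= [ss] /andP[a0 s0] as_ qE.
have a0' : (0 : rat) < a%:R by rewrite ltr0n.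
have s_le : \sum_(x <- s) (x%:R^-1 : rat) <= k%:R / a%:R.
  rewrite -ss mulr_natl -[X in _ *+ X]card_ord -sumr_const.
  rewrite (big_nth 0%N) big_mkord; apply: ler_sum => i _.
  have xs : nth 0%N s i \in s by rewrite mem_nth.
  have := allP s0 _ xs => x0.
  rewrite lef_pV2 ?posrE ?ltr0n// ler_nat.
  have /allP := order_path_min leq_trans as_; exact.
have qa : q * a%:R <= k.+1%:R.
  rewrite -ler_pdivlMr// qE big_cons -natr1 mulrDl mul1r addrC.
  by rewrite lerD2r.
have q0 : 0 < q.
  rewrite qE big_cons ltr_pwDl ?invr_gt0//.
  by apply: sumr_ge0 => x _; rewrite invr_ge0.
exists a => /=.
  rewrite /N ltnS -(ler_nat rat).
  apply: (@le_trans _ _ (k.+1%:R / q)); first by rewrite ler_pdivlMr// mulrC.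
  by apply/ltW/archi_boundP; rewrite divr_ge0// ltW.
exists s => //; split => //; first exact: path_sorted as_.
by rewrite qE big_cons addrC addKr.
Qed.

Lemma finite_unit_fraction_reps (k m n : nat) :
  finite_set (unit_fraction_reps k m n).
Proof.
have := finite_unit_fraction_seqs k (m%:R / n%:R).
move=> /(finite_preimage (f := @tval k nat)) fin.
apply: sub_finite_set (fin _) => [a [a0 as_ E]|x y _ _ ]; last exact: val_inj.
by split => //; rewrite ?size_tuple// E big_tuple.
Qed.

(* Main.v *)
Require Import Defs.
From HB Require Import structures.
From mathcomp Require Import all_boot all_order all_algebra.
From mathcomp Require Import finmap.
From mathcomp Require Import all_classical all_reals all_analysis.
From mathcomp Require Import zify ring lra.

(* Write [a_i = n t_i / N_i] in lowest terms, [N_i = n / gcd (a_i, n)]. Each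
   [t_i] divides the lcm of the others, so the [t_i] factor into relative gcds:
   [t_i] is the product of the [x_I], [i] in [I], where [I] runs through the
   index sets of size at least two, and [m / n = sum 1 / a_i] becomes
   [m prod x_I = sum_i N_i prod_(I without i) x_I]. The [N_i] divide [n], and up
   to divisor functions, which cost [n ^ eps], certain products of the [x_I]
   and of the quotients appearing in this equation ("codes") already determine
   the solution. A weighted geometric mean of the codes is bounded by the sizes
   of the [a_i]; hence one code is small and the solutions are few.

   Three fractions: with [d = x_123], [a = x_12], [b = x_13], the codes [ab],
   [da], [db] have [(ab) (da) (db) <= 9 n^2 / m^2]. If [e] and [g] are the
   quotients of [m t_1 - N_1] by [gcd (N_2, N_3)] and of [m t_3 - N_3] by
   [gcd (N_1, N_2)], then also [(ab) (da)^2 e g <= 36 n^3 / m^2]. This gives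
   the bounds [(n / m)^(2/3)] and [(n^3 / m^2)^(1/5)].

   Four fractions: let [j = t_1 - floor (N_1 / m)]. If [j = 1], then [N_1]
   determines [a_1], and the three fraction bounds for [m / n - 1 / a_1] give
   [(n^2 / m)^(2/3)] and [(n^2 / m)^(3/5)]. If [j >= 2], then the three codes
   [c1 = j x_23 x_234], [c2 = x_12 x_123 x_124 x_1234 z], where [z] is the
   numerator of [m / n - 1 / a_1 - 1 / a_2] over [n lcm (t_1, t_2)], and
   [c3 = x_12 x_24 x_124 x_13 x_34 x_134 x_123 x_1234] satisfy
   [c1^2 c2 c3 <= 4608 n^6 / m^5], which gives [n^(3/2) / m^(5/4)]. *)

Set Implicit Arguments.
Unset Strict Implicit.

(** * Divisors and relative greatest common divisors *)

(** A divisor is determined by its [p]-part, with [a.+1] choices, and its [p']-part, which divides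
    [m]. *)
Lemma divisors_pfactor_mul (p a m : nat) : prime p -> coprime p m -> 0 < m ->
  size (divisors (p ^ a * m)) <= a.+1 * size (divisors m).
Proof.
move=> pp cpm m0.
pose s := [seq p ^ i * d | i <- iota 0 a.+1, d <- divisors m].
have -> : a.+1 * size (divisors m) = size s by rewrite size_allpairs size_iota.
have pa0 : 0 < p ^ a * m by rewrite muln_gt0 expn_gt0 prime_gt0.
apply: uniq_leq_size; first exact: divisors_uniq.
move=> d; rewrite -dvdn_divisors// => dv.
have d0 : 0 < d := dvdn_gt0 pa0 dv.
have -> : d = p ^ logn p d * d`_p^' by rewrite -p_part partnC.
apply: allpairs_f.
  rewrite mem_iota /= add0n ltnS.
  have := dvdn_leq_log p pa0 dv.
  have pa1 : 0 < p ^ a by rewrite expn_gt0 prime_gt0.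
  rewrite lognM// pfactorK// (lognE p m).
  by rewrite m0 pp /= -[p %| m]negbK -prime_coprime// cpm addn0.
rewrite -dvdn_divisors//.
have cp : coprime d`_p^' (p ^ a).
  rewrite coprimeXr// coprime_sym prime_coprime//.
  have: p^'.-nat d`_p^' by exact: part_pnat.
  by rewrite p'natE.
by rewrite -(Gauss_dvdr _ cp) (dvdn_trans _ dv)// dvdn_part.
Qed.

(** The number with valuation [f p] at each prime [p]; the cutoff [B] makes the product finite, and
    in the applications [f] vanishes from [B] on. *)
Definition vprod (B : nat) (f : nat -> nat) :=
  \prod_(0 <= p < B | prime p) p ^ f p.

Lemma vprod_gt0 B f : 0 < vprod B f.
Proof. by apply: prodn_cond_gt0 => p pp; rewrite expn_gt0 prime_gt0. Qed.

Lemma logn_vprod (B : nat) (f : nat -> nat) (p : nat) :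
  (B <= p -> f p = 0) -> prime p -> logn p (vprod B f) = f p.
Proof.
move=> fB pp.
have -> : f p = if p < B then f p else 0 by case: ltnP => // /fB.
elim: B {fB} => [|B IH]; first by rewrite /vprod big_nil logn1.
rewrite /vprod big_mkcond big_nat_recr//= -big_mkcond /= -/(vprod _ _).
have B0 : 0 < if prime B then B ^ f B else 1.
  by case: ifP => // /prime_gt0 B0; rewrite expn_gt0 B0.
rewrite lognM ?vprod_gt0// IH ltnS.
have [pB|npB] := boolP (prime B); last first.
  rewrite logn1 addn0; case: ltngtP => // e.
  by rewrite e (negbTE npB) in pp.
rewrite lognX logn_prime// eq_sym.
by case: ltngtP => [lt|lt|->]; rewrite ?muln0 ?addn0 ?add0n ?muln1.
Qed.

Lemma eqn_logn (m n : nat) : 0 < m -> 0 < n ->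
  (forall p, prime p -> logn p m = logn p n) -> m = n.
Proof.
move=> m0 n0 H; apply: eqn_from_log => // p.
by case: (boolP (prime p)) => [/H//|np]; rewrite (lognE p m) (lognE p n) (negbTE np).
Qed.

Lemma logn_small (p t : nat) : t < p -> logn p t = 0.
Proof.
move=> tp; rewrite lognE; case: posnP => t0; first by rewrite !andbF.
by rewrite gtnNdvd// !andbF.
Qed.

Lemma coprime_vprod B f g :
  (forall p, B <= p -> f p = 0) -> (forall p, B <= p -> g p = 0) ->
  (forall p, f p = 0 \/ g p = 0) -> coprime (vprod B f) (vprod B g).
Proof.
move=> fB gB fg; rewrite /coprime; apply/eqP/eqn_logn => //.
  by rewrite gcdn_gt0 vprod_gt0.
move=> p pp; rewrite logn1 logn_gcd ?vprod_gt0// !logn_vprod; auto.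
by case: (fg p) => ->; rewrite ?min0n ?minn0.
Qed.

(* Called once the order of the variables is fixed: [lia] alone would split on
   every [minn] and [maxn]. *)
Ltac resolve_minmax := repeat match goal with
  | |- context [minn ?a ?b] => first
     [ rewrite (@minn_idPl a b); [|by lia] | rewrite (@minn_idPr a b); [|by lia] ]
  | |- context [maxn ?a ?b] => first
     [ rewrite (@maxn_idPl a b); [|by lia] | rewrite (@maxn_idPr a b); [|by lia] ]
  end.

(** The variables are valuations at one prime, and the hypotheses say that the largest value is
    attained twice. If [a = b >= c], say, then [d = c], [x12 = a - c] and [x13 = x23 = 0]. *)
Lemma venn3 (a b c : nat) :
  a <= maxn b c -> b <= maxn a c -> c <= maxn a b ->
  let d := minn a (minn b c) in let x12 := minn a b - c in
  let x13 := minn a c - b in let x23 := minn b c - a in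
  [/\ a = d + x12 + x13, b = d + x12 + x23 & c = d + x13 + x23].
Proof.
case: (leqP a b) => ab; case: (leqP a c) => ac; case: (leqP b c) => bc;
try (exfalso; lia).
all: resolve_minmax; move=> ? ? ? /=; split; lia.
Qed.

(** Again the largest value is attained twice. An index set with positive exponent is an upper level
    set of the valuations, so such sets are nested; the disjoint pairs {1,4} and {2,3} cannot both
    occur. *)
Lemma venn4 (a b c d : nat) :
  a <= maxn b (maxn c d) -> b <= maxn a (maxn c d) ->
  c <= maxn a (maxn b d) -> d <= maxn a (maxn b c) ->
  let x12 := minn a b - maxn c d in let x13 := minn a c - maxn b d in
  let x14 := minn a d - maxn b c in let x23 := minn b c - maxn a d in
  let x24 := minn b d - maxn a c in let x34 := minn c d - maxn a b in
  let x123 := minn a (minn b c) - d in let x124 := minn a (minn b d) - c in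
  let x134 := minn a (minn c d) - b in let x234 := minn b (minn c d) - a in
  let x1234 := minn a (minn b (minn c d)) in
  [/\ a = x12 + x13 + x14 + x123 + x124 + x134 + x1234,
      b = x12 + x23 + x24 + x123 + x124 + x234 + x1234,
      c = x13 + x23 + x34 + x123 + x134 + x234 + x1234,
      d = x14 + x24 + x34 + x124 + x134 + x234 + x1234
    & x14 = 0 \/ x23 = 0].
Proof.
case: (leqP a b) => ab; case: (leqP a c) => ac; case: (leqP a d) => ad;
case: (leqP b c) => bc; case: (leqP b d) => bd; case: (leqP c d) => cd;
try (exfalso; lia).
all: resolve_minmax; move=> ? ? ? ? /=; split; lia.
Qed.

(** Divisibility by the lcm bounds each valuation by the larger of the other two, so [venn3] applies
    at every prime. *)
Lemma relative_gcd3 (t1 t2 t3 : nat) : 0 < t1 -> 0 < t2 -> 0 < t3 ->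
  t1 %| lcmn t2 t3 -> t2 %| lcmn t1 t3 -> t3 %| lcmn t1 t2 ->
  exists d a b c, [/\ t1 = d * a * b, t2 = d * a * c & t3 = d * b * c].
Proof.
move=> t10 t20 t30 d1 d2 d3.
pose B := (t1 + t2 + t3).+1.
pose f1 p := logn p t1; pose f2 p := logn p t2; pose f3 p := logn p t3.
have big p : B <= p -> [/\ f1 p = 0, f2 p = 0 & f3 p = 0].
  by rewrite /B /f1 /f2 /f3 => Bp; rewrite !logn_small//; lia.
have dom p : [/\ f1 p <= maxn (f2 p) (f3 p), f2 p <= maxn (f1 p) (f3 p)
    & f3 p <= maxn (f1 p) (f2 p)].
  by split; rewrite -logn_lcm// dvdn_leq_log// lcmn_gt0; apply/andP.
exists (vprod B (fun p => minn (f1 p) (minn (f2 p) (f3 p)))).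
exists (vprod B (fun p => minn (f1 p) (f2 p) - f3 p)).
exists (vprod B (fun p => minn (f1 p) (f3 p) - f2 p)).
exists (vprod B (fun p => minn (f2 p) (f3 p) - f1 p)).
have V p := let: And3 h1 h2 h3 := dom p in venn3 h1 h2 h3.
split; apply: eqn_logn; rewrite ?muln_gt0 ?vprod_gt0//
  => p pp; rewrite !lognM ?muln_gt0 ?vprod_gt0//;
  (rewrite !logn_vprod//; try by move=> /big[]-> -> ->);
  by case: (V p).
Qed.

(* At each prime, [x_I] has the exponent by which the smallest valuation of the
   [t_i] with [i] in [I] exceeds the largest valuation of the others. *)
Lemma relative_gcd4 (t1 t2 t3 t4 : nat) :
  0 < t1 -> 0 < t2 -> 0 < t3 -> 0 < t4 ->
  t1 %| lcmn t2 (lcmn t3 t4) -> t2 %| lcmn t1 (lcmn t3 t4) ->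
  t3 %| lcmn t1 (lcmn t2 t4) -> t4 %| lcmn t1 (lcmn t2 t3) ->
  exists x12 x13 x14 x23 x24 x34 x123 x124 x134 x234 x1234,
  [/\ t1 = x12 * x13 * x14 * x123 * x124 * x134 * x1234,
      t2 = x12 * x23 * x24 * x123 * x124 * x234 * x1234,
      t3 = x13 * x23 * x34 * x123 * x134 * x234 * x1234,
      t4 = x14 * x24 * x34 * x124 * x134 * x234 * x1234
    & coprime x14 x23].
Proof.
move=> t10 t20 t30 t40 d1 d2 d3 d4.
pose B := (t1 + t2 + t3 + t4).+1.
pose f1 p := logn p t1; pose f2 p := logn p t2.
pose f3 p := logn p t3; pose f4 p := logn p t4.
have big p : B <= p -> [/\ f1 p = 0, f2 p = 0, f3 p = 0 & f4 p = 0].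
  by rewrite /B /f1 /f2 /f3 /f4 => Bp; rewrite !logn_small//; lia.
have dom p : [/\ f1 p <= maxn (f2 p) (maxn (f3 p) (f4 p)),
    f2 p <= maxn (f1 p) (maxn (f3 p) (f4 p)),
    f3 p <= maxn (f1 p) (maxn (f2 p) (f4 p))
    & f4 p <= maxn (f1 p) (maxn (f2 p) (f3 p))].
  by split; rewrite -!logn_lcm ?lcmn_gt0 ?t10 ?t20 ?t30 ?t40// dvdn_leq_log//
    ?lcmn_gt0 ?t10 ?t20 ?t30 ?t40.
exists (vprod B (fun p => minn (f1 p) (f2 p) - maxn (f3 p) (f4 p))).
exists (vprod B (fun p => minn (f1 p) (f3 p) - maxn (f2 p) (f4 p))).
exists (vprod B (fun p => minn (f1 p) (f4 p) - maxn (f2 p) (f3 p))).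
exists (vprod B (fun p => minn (f2 p) (f3 p) - maxn (f1 p) (f4 p))).
exists (vprod B (fun p => minn (f2 p) (f4 p) - maxn (f1 p) (f3 p))).
exists (vprod B (fun p => minn (f3 p) (f4 p) - maxn (f1 p) (f2 p))).
exists (vprod B (fun p => minn (f1 p) (minn (f2 p) (f3 p)) - f4 p)).
exists (vprod B (fun p => minn (f1 p) (minn (f2 p) (f4 p)) - f3 p)).
exists (vprod B (fun p => minn (f1 p) (minn (f3 p) (f4 p)) - f2 p)).
exists (vprod B (fun p => minn (f2 p) (minn (f3 p) (f4 p)) - f1 p)).
exists (vprod B (fun p => minn (f1 p) (minn (f2 p) (minn (f3 p) (f4 p))))).
have V p := let: And4 h1 h2 h3 h4 := dom p in venn4 h1 h2 h3 h4.
split; last by apply: coprime_vprod => [p /big|p /big|p];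
  [by case=> -> -> -> ->|by case=> -> -> -> ->|by case: (V p)].
all: apply: eqn_logn; rewrite ?muln_gt0 ?vprod_gt0//
  => p pp; rewrite !lognM ?muln_gt0 ?vprod_gt0//;
  (rewrite !logn_vprod//; try by move=> /big[]-> -> -> ->);
  by case: (V p).
Qed.

(** * Enumeration by divisors *)

(** Nested choices are modelled by the monadic bind of lists, so that their numbers multiply. *)
Definition bind (S T : Type) (s : seq S) (f : S -> seq T) : seq T :=
  flatten (map f s).

Lemma mem_bind (S T : eqType) (x : S) (s : seq S) (f : S -> seq T) (y : T) :
  x \in s -> y \in f x -> y \in bind s f.
Proof. by move=> xs yf; apply/flatten_mapP; exists x. Qed.

Lemma size_bind (S T : Type) (s : seq S) (f : S -> seq T) (k l : nat) :
  size s <= k -> (forall x, size (f x) <= l) -> size (bind s f) <= k * l.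
Proof.
move=> sk fl; apply: leq_trans (leq_mul sk (leqnn l)) => {sk k}.
rewrite /bind; elim: s => //= x s IH.
by rewrite size_cat mulSn leq_add.
Qed.

(* Divisors, cut off above [B] so that the length of the list is bounded
   uniformly in the argument. *)
Definition dv (B x : nat) := if x <= B then divisors x else [::].

Lemma mem_dv (B x d : nat) : x <= B -> 0 < x -> d %| x -> d \in dv B x.
Proof. by move=> xB x0 dx; rewrite /dv xB -dvdn_divisors. Qed.

Lemma size_dv (B D x : nat) :
  (forall y, y <= B -> size (divisors y) <= D) -> size (dv B x) <= D.
Proof. by move=> H; rewrite /dv; case: ifP => // /H. Qed.

Lemma size_bind_dv (T : Type) (B D x k l : nat) (f : nat -> seq T) :
  (forall y, y <= B -> size (divisors y) <= D) ->
  (forall y, size (f y) <= D ^ k) -> size (bind (dv B x) f) <= D ^ k.+1.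
Proof. by move=> HD Hf; rewrite expnS; apply: size_bind Hf; apply: size_dv. Qed.

(* The solutions of [al * x * y = be * x + ga * y + de], which is equivalent to
   [(al * x - ga) * (al * y - be) = be * ga + al * de]. *)
Definition bilinear (B al be ga de : nat) : seq (nat * nat) :=
  [seq ((ga + s) %/ al, (be + (be * ga + al * de) %/ s) %/ al)
    | s <- dv B (be * ga + al * de)].

Lemma mem_bilinear (B al be ga de x y : nat) :
  0 < be -> 0 < ga -> 0 < x -> 0 < y -> be * ga + al * de <= B ->
  al * x * y = be * x + ga * y + de -> (x, y) \in bilinear B al be ga de.
Proof.
move=> be0 ga0 x0 y0 WB E.
(* As [be] and [ga] are positive, so are [al * x - ga] and [al * y - be]; the truncated subtractions
   below are exact. *)
have lt1 : ga < al * x by rewrite -(ltn_pmul2r y0) E; nia.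
have lt2 : be < al * y by rewrite -(ltn_pmul2r x0) mulnAC E; nia.
have al0 : 0 < al by case: al lt1 {E lt2 WB}.
have [s Es] : exists s, al * x = ga + s by exists (al * x - ga); rewrite subnKC// ltnW.
have [r Er] : exists r, al * y = be + r by exists (al * y - be); rewrite subnKC// ltnW.
have s0 : 0 < s by lia.
have W : be * ga + al * de = r * s.
  have : (ga + s) * (be + r) = al * (be * x + ga * y + de).
    by rewrite -Es -Er -E; ring.
  rewrite !mulnDr !mulnDl (mulnCA al be) (mulnCA al ga) Es Er; lia.
apply/mapP; exists s; first by apply: mem_dv => //; rewrite W ?dvdn_mull//; lia.
by rewrite W mulnK// -Es -Er !mulKn.
Qed.

Lemma size_bilinear (B D al be ga de : nat) :
  (forall y, y <= B -> size (divisors y) <= D) ->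
  size (bilinear B al be ga de) <= D.
Proof. by move=> H; rewrite size_map; apply: size_dv. Qed.

Lemma mem_iota1 (q Q : nat) : 0 < q -> q <= Q -> q \in iota 1 Q.
Proof. by move=> q0 qQ; rewrite mem_iota q0 add1n ltnS. Qed.

Lemma expn_bound_le (A k l x : nat) : 1 < A -> x <= A ^ k -> k <= l -> x <= A ^ l.
Proof. by move=> A1 xk kl; apply: leq_trans xk _; rewrite leq_exp2l. Qed.

Lemma expn_bound_mul (A i j x y : nat) :
  x <= A ^ i -> y <= A ^ j -> x * y <= A ^ (i + j).
Proof. by move=> xi yj; rewrite expnD leq_mul. Qed.

Lemma expn_bound_add (A i j x y : nat) : 1 < A ->
  x <= A ^ i -> y <= A ^ j -> x + y <= A ^ (i + j).+1.
Proof.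
move=> A1 xi yj; have A0 : 0 < A by lia.
apply: (@leq_trans (A ^ (i + j) + A ^ (i + j))).
  by apply: leq_add; [apply: leq_trans xi _|apply: leq_trans yj _];
    rewrite leq_pexp2l//; lia.
by rewrite addnn -mul2n expnS leq_mul.
Qed.

Lemma expn_bound1 (A x : nat) : x <= A -> x <= A ^ 1.
Proof. by []. Qed.

(** The exponent is left open, found from the shape of the expression, and only then compared with
    the one in the goal. *)
Ltac expn_bound A1 :=
  eapply (@expn_bound_le _ _ _ _ A1);
  [repeat first [ apply: (@expn_bound_add _ _ _ _ _ A1)
                | apply: expn_bound_mul | by apply: expn_bound1 | eassumption ]
  | by []].

(** * Reduction to lowest terms *)

Lemma reduced_denominator (a n : nat) : 0 < a -> 0 < n ->
  exists N t, [/\ 0 < N, 0 < t, N %| n, a * N = n * t & coprime t N].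
Proof.
move=> a0 n0; set g := gcdn a n; have g0 : 0 < g by rewrite gcdn_gt0 a0.
have [N nE] := dvdnP (dvdn_gcdr a n); have [t aE] := dvdnP (dvdn_gcdl a n).
rewrite -/g in nE aE.
exists N, t; split.
- by case: N nE n0 => [->|].
- by case: t aE a0 => [->|].
- by rewrite nE dvdn_mulr.
- by rewrite [in LHS]aE [in RHS]nE; ring.
- have : gcdn (t * g) (N * g) = 1 * g by rewrite -aE -nE mul1n.
  by rewrite -muln_gcdl => /eqP; rewrite eqn_pmul2r.
Qed.

Lemma reduced_equation3 (m n a1 a2 a3 N1 N2 N3 t1 t2 t3 : nat) : 0 < n ->
  a1 * N1 = n * t1 -> a2 * N2 = n * t2 -> a3 * N3 = n * t3 ->
  m * a1 * a2 * a3 = n * (a2 * a3 + a1 * a3 + a1 * a2) ->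
  m * t1 * t2 * t3 = N1 * t2 * t3 + N2 * t1 * t3 + N3 * t1 * t2.
Proof.
move=> n0 E1 E2 E3 E; apply/eqP; rewrite -(@eqn_pmul2l (n * n * n)) ?muln_gt0 ?n0//.
apply/eqP; transitivity (m * (n * t1) * (n * t2) * (n * t3)); first by ring.
rewrite -E1 -E2 -E3.
transitivity ((m * a1 * a2 * a3) * (N1 * N2 * N3)); first by ring.
rewrite E; transitivity (n * (N1 * (a2 * N2) * (a3 * N3) +
  N2 * (a1 * N1) * (a3 * N3) + N3 * (a1 * N1) * (a2 * N2))); first by ring.
by rewrite E1 E2 E3; ring.
Qed.

Lemma reduced_equation4 (m n a1 a2 a3 a4 N1 N2 N3 N4 t1 t2 t3 t4 : nat) :
  0 < n -> a1 * N1 = n * t1 -> a2 * N2 = n * t2 -> a3 * N3 = n * t3 ->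
  a4 * N4 = n * t4 ->
  m * a1 * a2 * a3 * a4 =
    n * (a2 * a3 * a4 + a1 * a3 * a4 + a1 * a2 * a4 + a1 * a2 * a3) ->
  m * t1 * t2 * t3 * t4 = N1 * t2 * t3 * t4 + N2 * t1 * t3 * t4 +
    N3 * t1 * t2 * t4 + N4 * t1 * t2 * t3.
Proof.
move=> n0 E1 E2 E3 E4 E; apply/eqP.
rewrite -(@eqn_pmul2l (n * n * n * n)) ?muln_gt0 ?n0//; apply/eqP.
transitivity (m * (n * t1) * (n * t2) * (n * t3) * (n * t4)); first by ring.
rewrite -E1 -E2 -E3 -E4.
transitivity ((m * a1 * a2 * a3 * a4) * (N1 * N2 * N3 * N4)); first by ring.
rewrite E; transitivity (n * (N1 * (a2 * N2) * (a3 * N3) * (a4 * N4) +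
  N2 * (a1 * N1) * (a3 * N3) * (a4 * N4) + N3 * (a1 * N1) * (a2 * N2) * (a4 * N4)
  + N4 * (a1 * N1) * (a2 * N2) * (a3 * N3))); first by ring.
by rewrite E1 E2 E3 E4; ring.
Qed.

(** Multiplying the equation by [l / (t2 * t3)], where [l] is the lcm, gives [t1 * (m * l) = N1 * l
    + t1 * (N2 * u2 + N3 * u3)]. So [t1] divides [N1 * l], and it is prime to [N1]. *)
Lemma dvdn_lcm_of_equation3 (m N1 N2 N3 t1 t2 t3 : nat) :
  0 < t2 -> 0 < t3 -> coprime t1 N1 ->
  m * t1 * t2 * t3 = N1 * t2 * t3 + N2 * t1 * t3 + N3 * t1 * t2 ->
  t1 %| lcmn t2 t3.
Proof.
move=> t20 t30 cop E; set l := lcmn t2 t3.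
have [u2 l2] := dvdnP (dvdn_lcml t2 t3); have [u3 l3] := dvdnP (dvdn_lcmr t2 t3).
rewrite -/l in l2 l3.
have El : t1 * (m * l) = N1 * l + t1 * (N2 * u2 + N3 * u3).
  apply/eqP; rewrite -(@eqn_pmul2l (t2 * t3)) ?muln_gt0 ?t20//; apply/eqP.
  transitivity (l * (m * t1 * t2 * t3)); first by ring.
  rewrite E; transitivity (t2 * t3 * (N1 * l) + N2 * t1 * t3 * l + N3 * t1 * t2 * l).
    by ring.
  by rewrite [in N2 * _ * _ * _]l2 [in N3 * _ * _ * _]l3; ring.
rewrite -(Gauss_dvdr _ cop) -(dvdn_addl _ (dvdn_mulr (N2 * u2 + N3 * u3) (dvdnn t1))).
by rewrite -El dvdn_mulr.
Qed.

Lemma dvdn_lcm_of_equation4 (m N1 N2 N3 N4 t1 t2 t3 t4 : nat) :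
  0 < t2 -> 0 < t3 -> 0 < t4 -> coprime t1 N1 ->
  m * t1 * t2 * t3 * t4 = N1 * t2 * t3 * t4 + N2 * t1 * t3 * t4 +
    N3 * t1 * t2 * t4 + N4 * t1 * t2 * t3 ->
  t1 %| lcmn t2 (lcmn t3 t4).
Proof.
move=> t20 t30 t40 cop E; set l := lcmn t2 (lcmn t3 t4).
have [u2 l2] : exists u, l = u * t2 by apply/dvdnP/dvdn_lcml.
have [u3 l3] : exists u, l = u * t3.
  by apply/dvdnP/(dvdn_trans (dvdn_lcml t3 t4))/dvdn_lcmr.
have [u4 l4] : exists u, l = u * t4.
  by apply/dvdnP/(dvdn_trans (dvdn_lcmr t3 t4))/dvdn_lcmr.
have El : t1 * (m * l) = N1 * l + t1 * (N2 * u2 + N3 * u3 + N4 * u4).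
  apply/eqP; rewrite -(@eqn_pmul2l (t2 * t3 * t4)) ?muln_gt0 ?t20 ?t30//.
  apply/eqP; transitivity (l * (m * t1 * t2 * t3 * t4)); first by ring.
  rewrite E; transitivity (t2 * t3 * t4 * (N1 * l) + N2 * t1 * t3 * t4 * l
    + N3 * t1 * t2 * t4 * l + N4 * t1 * t2 * t3 * l); first by ring.
  by rewrite [in N2 * _ * _ * _ * _]l2 [in N3 * _ * _ * _ * _]l3
    [in N4 * _ * _ * _ * _]l4; ring.
rewrite -(Gauss_dvdr _ cop).
rewrite -(dvdn_addl _ (dvdn_mulr (N2 * u2 + N3 * u3 + N4 * u4) (dvdnn t1))).
by rewrite -El dvdn_mulr.
Qed.

(** * Sums of three unit fractions *)

(* The exponent 100 exceeds the degree of every polynomial expression whose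
   divisors are enumerated. *)
Definition few_divisors (A D : nat) :=
  forall y, y <= A ^ 100 -> size (divisors y) <= D.

(** The denominators [a_i = n t_i / N_i], rebuilt from the enumerated data. *)
Definition sol3 (n N1 N2 N3 d a b c : nat) : seq nat :=
  [:: n * (d * a * b) %/ N1; n * (d * a * c) %/ N2; n * (d * b * c) %/ N3].

(** Here [c] is [x_23], and the equation is that of [reduced_equation3] divided by
    [d ^ 2 * a * b * c]. The coprimality conditions serve to extract [gcdn N1 N2] and [gcdn N2 N3]
    in [cover3]. *)
Record system3 (A m n N1 N2 N3 d a b c : nat) : Prop := System3 {
  sys3_gt0 : [/\ 0 < N1, 0 < N2 & 0 < N3] /\ [/\ 0 < d, 0 < a, 0 < b & 0 < c];
  sys3_le : [/\ N1 <= A, N2 <= A & N3 <= A] /\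
    [/\ d <= A, a <= A, b <= A & c <= A];
  sys3_dvd : [/\ N1 %| n, N2 %| n & N3 %| n];
  sys3_coprime : coprime a N1 /\ coprime c N2;
  sys3_eq : m * d * a * b * c = N1 * c + N2 * b + N3 * a }.

Ltac unpack3 S :=
  have [[N10 N20 N30] [d0 a0 b0 c0]] := sys3_gt0 S;
  have [[N1A N2A N3A] [dA aA bA cA]] := sys3_le S;
  have [N1n N2n N3n] := sys3_dvd S; have E := sys3_eq S.

Ltac size_cover H :=
  apply: size_bind; [by rewrite size_iota | move=> ?];
  repeat (apply: size_bind_dv => // ?); 
  first [by [] | by rewrite expn1 size_map; apply: size_bilinear].

Section Codes3.
Variables (A D m n Q : nat).
Hypotheses (A1 : 1 < A) (m0 : 0 < m) (n0 : 0 < n) (mA : m <= A) (nA : n <= A).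
Hypothesis HD : few_divisors A D.
Let B := A ^ 100.

Let nB : n <= B.
Proof. by expn_bound A1. Qed.

(** Given the [N_i], [a] and [b], the equation shows that [c] divides [N2 * b + N3 * a], and then it
    determines [d]. *)
Lemma cover3_ab : exists L : seq (seq nat), size L <= Q * D ^ 5 /\
  forall N1 N2 N3 d a b c, system3 A m n N1 N2 N3 d a b c -> a * b <= Q ->
    sol3 n N1 N2 N3 d a b c \in L.
Proof.
exists (bind (iota 1 Q) (fun q => bind (dv B n) (fun N1 => bind (dv B n) (fun N2 =>
  bind (dv B n) (fun N3 => bind (dv B q) (fun a => let b := q %/ a in
  bind (dv B (N2 * b + N3 * a)) (fun c =>
  let d := (N1 * c + N2 * b + N3 * a) %/ (m * a * b * c) in
  [:: sol3 n N1 N2 N3 d a b c]))))))); split.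
  by size_cover HD.
move=> N1 N2 N3 d a b c S abQ; unpack3 S.
apply: (@mem_bind _ _ (a * b)); first by rewrite mem_iota1// muln_gt0 a0.
apply: (@mem_bind _ _ N1); first exact: mem_dv nB _ _.
apply: (@mem_bind _ _ N2); first exact: mem_dv nB _ _.
apply: (@mem_bind _ _ N3); first exact: mem_dv nB _ _.
apply: (@mem_bind _ _ a); first by apply: mem_dv; [expn_bound A1|rewrite muln_gt0 a0|
  exact: dvdn_mulr].
rewrite /= mulKn//; apply: (@mem_bind _ _ c).
  apply: mem_dv; [by expn_bound A1|by rewrite addn_gt0 !muln_gt0 N20 b0|].
  rewrite -(dvdn_addr _ (dvdn_mull N1 (dvdnn c))) addnA -E; exact: dvdn_mull.
rewrite -E (_ : m * d * a * b * c = d * (m * a * b * c)); last by ring.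
by rewrite mulnK ?mem_seq1// !muln_gt0 m0 a0 b0.
Qed.

(** With [d] and [a] fixed the equation is bilinear in [b] and [c]. *)
Lemma cover3_da : exists L : seq (seq nat), size L <= Q * D ^ 5 /\
  forall N1 N2 N3 d a b c, system3 A m n N1 N2 N3 d a b c -> d * a <= Q ->
    sol3 n N1 N2 N3 d a b c \in L.
Proof.
exists (bind (iota 1 Q) (fun q => bind (dv B n) (fun N1 => bind (dv B n) (fun N2 =>
  bind (dv B n) (fun N3 => bind (dv B q) (fun a => let d := q %/ a in
  [seq sol3 n N1 N2 N3 d a bc.1 bc.2 |
    bc <- bilinear B (m * d * a) N2 N1 (N3 * a)])))))); split.
  by size_cover HD.
move=> N1 N2 N3 d a b c S daQ; unpack3 S.
apply: (@mem_bind _ _ (d * a)); first by rewrite mem_iota1// muln_gt0 d0.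
apply: (@mem_bind _ _ N1); first exact: mem_dv nB _ _.
apply: (@mem_bind _ _ N2); first exact: mem_dv nB _ _.
apply: (@mem_bind _ _ N3); first exact: mem_dv nB _ _.
apply: (@mem_bind _ _ a).
  by apply: mem_dv; [expn_bound A1|rewrite muln_gt0 d0|exact: dvdn_mull].
rewrite /= mulnK//; apply/mapP; exists (b, c) => //.
by apply: mem_bilinear => //; [expn_bound A1|rewrite E; ring].
Qed.

(** With [d] and [b] fixed the equation is bilinear in [a] and [c]. *)
Lemma cover3_db : exists L : seq (seq nat), size L <= Q * D ^ 5 /\
  forall N1 N2 N3 d a b c, system3 A m n N1 N2 N3 d a b c -> d * b <= Q ->
    sol3 n N1 N2 N3 d a b c \in L.
Proof.
exists (bind (iota 1 Q) (fun q => bind (dv B n) (fun N1 => bind (dv B n) (fun N2 =>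
  bind (dv B n) (fun N3 => bind (dv B q) (fun b => let d := q %/ b in
  [seq sol3 n N1 N2 N3 d ac.1 b ac.2 |
    ac <- bilinear B (m * d * b) N3 N1 (N2 * b)])))))); split.
  by size_cover HD.
move=> N1 N2 N3 d a b c S dbQ; unpack3 S.
apply: (@mem_bind _ _ (d * b)); first by rewrite mem_iota1// muln_gt0 d0.
apply: (@mem_bind _ _ N1); first exact: mem_dv nB _ _.
apply: (@mem_bind _ _ N2); first exact: mem_dv nB _ _.
apply: (@mem_bind _ _ N3); first exact: mem_dv nB _ _.
apply: (@mem_bind _ _ b).
  by apply: mem_dv; [expn_bound A1|rewrite muln_gt0 d0|exact: dvdn_mull].
rewrite /= mulnK//; apply/mapP; exists (a, c) => //.
apply: mem_bilinear => //; first by expn_bound A1.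
by transitivity (m * d * a * b * c); [ring|rewrite E; ring].
Qed.

(* [q] is the quotient of [m * t1 - N1] by [gcdn N2 N3], where [t1 = d * a * b]. *)
Lemma cover3_first : exists L : seq (seq nat), size L <= Q * D ^ 5 /\
  forall N1 N2 N3 d a b c q, system3 A m n N1 N2 N3 d a b c ->
    q <= Q -> m * (d * a * b) = N1 + gcdn N2 N3 * q ->
    sol3 n N1 N2 N3 d a b c \in L.
Proof.
exists (bind (iota 1 Q) (fun q => bind (dv B n) (fun N1 => bind (dv B n) (fun N2 =>
  bind (dv B n) (fun N3 => let e := gcdn N2 N3 * q in let t := (N1 + e) %/ m in
  bind (dv B t) (fun d => bind (dv B t) (fun a => let b := t %/ (d * a) in
  [:: sol3 n N1 N2 N3 d a b ((N2 * b + N3 * a) %/ e)]))))))); split.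
  by size_cover HD.
move=> N1 N2 N3 d a b c q S qQ tE; unpack3 S.
(* The equation minus [N1 * c]: once [d], [a] and [b] are found among the divisors of [t1], it gives
   [c] as a quotient. *)
have eE : gcdn N2 N3 * q * c = N2 * b + N3 * a.
  apply: (@addnI (N1 * c)); transitivity (c * (N1 + gcdn N2 N3 * q)); first by ring.
  by rewrite -tE; transitivity (m * d * a * b * c); [ring|rewrite E; ring].
have e0 : 0 < gcdn N2 N3 * q.
  have : 0 < gcdn N2 N3 * q * c by rewrite eE addn_gt0 !muln_gt0 N20 b0.
  by rewrite muln_gt0 => /andP[].
apply: (@mem_bind _ _ q).
  by rewrite mem_iota1//; move: e0; rewrite muln_gt0 => /andP[].
apply: (@mem_bind _ _ N1); first exact: mem_dv nB _ _.
apply: (@mem_bind _ _ N2); first exact: mem_dv nB _ _.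
apply: (@mem_bind _ _ N3); first exact: mem_dv nB _ _.
rewrite /= -tE mulKn//.
apply: (@mem_bind _ _ d).
  apply: mem_dv; [by expn_bound A1|by rewrite !muln_gt0 d0 a0|].
  by rewrite -mulnA dvdn_mulr.
apply: (@mem_bind _ _ a).
  apply: mem_dv; [by expn_bound A1|by rewrite !muln_gt0 d0 a0|].
  by rewrite mulnAC dvdn_mull.
by rewrite mulKn ?muln_gt0 ?d0// -eE mulKn// mem_seq1.
Qed.

(* Likewise for the quotient of [m * t3 - N3] by [gcdn N1 N2], [t3 = d * b * c]. *)
Lemma cover3_last : exists L : seq (seq nat), size L <= Q * D ^ 5 /\
  forall N1 N2 N3 d a b c q, system3 A m n N1 N2 N3 d a b c ->
    q <= Q -> m * (d * b * c) = N3 + gcdn N1 N2 * q ->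
    sol3 n N1 N2 N3 d a b c \in L.
Proof.
exists (bind (iota 1 Q) (fun q => bind (dv B n) (fun N1 => bind (dv B n) (fun N2 =>
  bind (dv B n) (fun N3 => let e := gcdn N1 N2 * q in let t := (N3 + e) %/ m in
  bind (dv B t) (fun d => bind (dv B t) (fun b => let c := t %/ (d * b) in
  [:: sol3 n N1 N2 N3 d ((N1 * c + N2 * b) %/ e) b c]))))))); split.
  by size_cover HD.
move=> N1 N2 N3 d a b c q S qQ tE; unpack3 S.
have eE : gcdn N1 N2 * q * a = N1 * c + N2 * b.
  apply: (@addnI (N3 * a)); transitivity (a * (N3 + gcdn N1 N2 * q)); first by ring.
  by rewrite -tE; transitivity (m * d * a * b * c); [ring|rewrite E; ring].
have e0 : 0 < gcdn N1 N2 * q.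
  have : 0 < gcdn N1 N2 * q * a by rewrite eE addn_gt0 !muln_gt0 N10 c0.
  by rewrite muln_gt0 => /andP[].
apply: (@mem_bind _ _ q).
  by rewrite mem_iota1//; move: e0; rewrite muln_gt0 => /andP[].
apply: (@mem_bind _ _ N1); first exact: mem_dv nB _ _.
apply: (@mem_bind _ _ N2); first exact: mem_dv nB _ _.
apply: (@mem_bind _ _ N3); first exact: mem_dv nB _ _.
rewrite /= -tE mulKn//.
apply: (@mem_bind _ _ d).
  apply: mem_dv; [by expn_bound A1|by rewrite !muln_gt0 d0 b0|].
  by rewrite -mulnA dvdn_mulr.
apply: (@mem_bind _ _ b).
  apply: mem_dv; [by expn_bound A1|by rewrite !muln_gt0 d0 b0|].
  by rewrite mulnAC dvdn_mull.
by rewrite mulKn ?muln_gt0 ?d0// -eE mulKn// mem_seq1.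
Qed.

End Codes3.

Lemma numerator_le (a n N t : nat) :
  0 < n -> N %| n -> a * N = n * t -> t <= a.
Proof.
move=> n0 Nn E; rewrite -(leq_pmul2l n0) -E mulnC leq_mul//.
exact: dvdn_leq.
Qed.

Lemma exists_system3 (A m n a1 a2 a3 : nat) :
  0 < n -> n <= A -> 0 < a1 -> 0 < a2 -> 0 < a3 ->
  a1 <= A -> a2 <= A -> a3 <= A ->
  m * a1 * a2 * a3 = n * (a2 * a3 + a1 * a3 + a1 * a2) ->
  exists N1 N2 N3 d a b c, [/\ system3 A m n N1 N2 N3 d a b c,
    a1 * N1 = n * (d * a * b), a2 * N2 = n * (d * a * c)
    & a3 * N3 = n * (d * b * c)].
Proof.
move=> n0 nA a10 a20 a30 a1A a2A a3A E.
have [N1 [t1 [N10 t10 N1n E1 co1]]] := reduced_denominator a10 n0.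
have [N2 [t2 [N20 t20 N2n E2 co2]]] := reduced_denominator a20 n0.
have [N3 [t3 [N30 t30 N3n E3 co3]]] := reduced_denominator a30 n0.
have Et := reduced_equation3 n0 E1 E2 E3 E.
have d1 := dvdn_lcm_of_equation3 t20 t30 co1 Et.
have d2 : t2 %| lcmn t1 t3.
  apply: (@dvdn_lcm_of_equation3 m N2 N1 N3) => //.
  by transitivity (m * t1 * t2 * t3); [ring|rewrite Et; ring].
have d3 : t3 %| lcmn t1 t2.
  apply: (@dvdn_lcm_of_equation3 m N3 N1 N2) => //.
  by transitivity (m * t1 * t2 * t3); [ring|rewrite Et; ring].
have [d [a [b [c [T1 T2 T3]]]]] := relative_gcd3 t10 t20 t30 d1 d2 d3.
have t1A := leq_trans (numerator_le n0 N1n E1) a1A.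
have t2A := leq_trans (numerator_le n0 N2n E2) a2A.
have t3A := leq_trans (numerator_le n0 N3n E3) a3A.
rewrite {}T1 {}T2 {}T3 in t10 t20 t30 E1 E2 E3 co1 co2 Et t1A t2A t3A *.
have [d0 a0 b0] : [/\ 0 < d, 0 < a & 0 < b].
  by move: t10; rewrite !muln_gt0 => /andP[/andP[]].
have c0 : 0 < c by move: t20; rewrite !muln_gt0 => /andP[].
exists N1, N2, N3, d, a, b, c; split=> //; split=> //.
- split; [by split; apply: leq_trans nA; apply: dvdn_leq|split].
  + by apply: leq_trans t1A; rewrite -mulnA leq_pmulr// muln_gt0 a0.
  + by apply: leq_trans t1A; rewrite mulnAC leq_pmull// muln_gt0 d0.
  + by apply: leq_trans t1A; rewrite leq_pmull// muln_gt0 d0.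
  + by apply: leq_trans t2A; rewrite leq_pmull// muln_gt0 d0.
- move: co1 co2; rewrite !coprimeMl => /andP[/andP[_ ->] _].
  by move=> /andP[_ ->].
- apply/eqP; rewrite -(@eqn_pmul2l (d * d * a * b * c)) ?muln_gt0 ?d0 ?a0 ?b0//.
  apply/eqP; transitivity (m * (d * a * b) * (d * a * c) * (d * b * c)).
    by ring.
  by rewrite Et; ring.
Qed.

Lemma sol3E (n a1 a2 a3 N1 N2 N3 d a b c : nat) :
  0 < N1 -> 0 < N2 -> 0 < N3 ->
  a1 * N1 = n * (d * a * b) -> a2 * N2 = n * (d * a * c) ->
  a3 * N3 = n * (d * b * c) -> sol3 n N1 N2 N3 d a b c = [:: a1; a2; a3].
Proof. by move=> N10 N20 N30; rewrite /sol3 => <- <- <-; rewrite !mulnK. Qed.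

(** With [u] a common factor of [t_i] and [t_j], this compares summands of the reduced equation: the
    smaller denominator has the larger summand. *)
Lemma term_le (n ai aj Ni Nj u vi vj : nat) :
  0 < n -> 0 < u -> 0 < Ni -> 0 < Nj ->
  ai <= aj -> ai * Ni = n * (u * vi) -> aj * Nj = n * (u * vj) ->
  Nj * vi <= Ni * vj.
Proof.
move=> n0 u0 Ni0 Nj0 aij Ei Ej.
rewrite -(@leq_pmul2l (n * u)) ?muln_gt0 ?n0//.
rewrite (_ : n * u * (Nj * vi) = Nj * (n * (u * vi))); last by ring.
rewrite (_ : n * u * (Ni * vj) = Ni * (n * (u * vj))); last by ring.
rewrite -Ei -Ej (_ : Nj * (ai * Ni) = Ni * Nj * ai); last by ring.
rewrite (_ : Ni * (aj * Nj) = Ni * Nj * aj); last by ring.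
by rewrite leq_mul.
Qed.

Lemma muln_gcd_le (n N1 N2 : nat) : 0 < n -> N1 %| n -> N2 %| n ->
  N1 * N2 <= gcdn N1 N2 * n.
Proof.
by move=> n0 N1n N2n; rewrite -muln_lcm_gcd mulnC leq_mul// dvdn_leq// dvdn_lcm N1n.
Qed.

(** If all five codes exceed [Q], each is at least [Q.+1], and a weighted product of them
    contradicts the assumption on [Q]. *)
Lemma cover3 (A D m n Q : nat) : 1 < A -> 0 < m -> 0 < n -> m <= A -> n <= A ->
  few_divisors A D ->
  (36 * n ^ 3 <= m ^ 2 * Q ^ 5) || (9 * n ^ 2 <= m ^ 2 * Q ^ 3) ->
  exists L : seq (seq nat), size L <= 5 * (Q * D ^ 5) /\
    forall a1 a2 a3, 0 < a1 -> a1 <= a2 -> a2 <= a3 -> a3 <= A ->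
      m * a1 * a2 * a3 = n * (a2 * a3 + a1 * a3 + a1 * a2) ->
      [:: a1; a2; a3] \in L.
Proof.
move=> A1 m0 n0 mA nA HD HQ.
have [L1 [s1 H1]] := cover3_ab Q A1 m0 n0 nA HD.
have [L2 [s2 H2]] := cover3_da Q A1 n0 mA nA HD.
have [L3 [s3 H3]] := cover3_db Q A1 n0 mA nA HD.
have [L4 [s4 H4]] := cover3_first Q A1 m0 n0 nA HD.
have [L5 [s5 H5]] := cover3_last Q A1 m0 n0 nA HD.
exists (L1 ++ L2 ++ L3 ++ L4 ++ L5); split; first by rewrite !size_cat; lia.
move=> a1 a2 a3 a10 a12 a23 a3A Ea.
have a20 : 0 < a2 by lia.
have a30 : 0 < a3 by lia.
have a1A : a1 <= A by lia.
have a2A : a2 <= A by lia.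
have [N1 [N2 [N3 [d [a [b [c [S E1 E2 E3]]]]]]]] :=
  exists_system3 n0 nA a10 a20 a30 a1A a2A a3A Ea.
unpack3 S; have [cop1 cop2] := sys3_coprime S.
rewrite -(sol3E N10 N20 N30 E1 E2 E3) !mem_cat.
have [/(H1 _ _ _ _ _ _ _ S) ->//|abQ] := leqP (a * b) Q.
have [/(H2 _ _ _ _ _ _ _ S) ->|daQ] := leqP (d * a) Q; first by rewrite orbT.
have [/(H3 _ _ _ _ _ _ _ S) ->|dbQ] := leqP (d * b) Q; first by rewrite !orbT.
have le12 : N2 * b <= N1 * c.
  by apply: (@term_le n a1 a2 N1 N2 (d * a)) => //; rewrite muln_gt0 d0.
have le23 : N3 * a <= N2 * b.
  apply: (@term_le n a2 a3 N2 N3 (d * c)) => //; first by rewrite muln_gt0 d0.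
    by rewrite E2; ring.
  by rewrite E3; ring.
(* [N1 * c] is the largest of the three summands, so [m * t1 <= 3 * N1]. *)
have tm : m * (d * a * b) <= 3 * n.
  apply: (@leq_trans (3 * N1)); last by rewrite leq_mul// dvdn_leq.
  rewrite -(leq_pmul2r c0) (_ : m * (d * a * b) * c = m * d * a * b * c); last by ring.
  by rewrite E; clear -le12 le23; lia.
case/orP: HQ => HQ; last first.
  exfalso.
  (* The product of [a * b], [d * a] and [d * b] is the square of [t1 = d * a * b]. *)
  have lt : m ^ 2 * Q.+1 ^ 3 <= (m * (d * a * b)) ^ 2.
    rewrite (_ : (m * (d * a * b)) ^ 2 = m ^ 2 * ((a * b) * (d * a) * (d * b))); last by ring.
    by rewrite leq_mul// (_ : Q.+1 ^ 3 = Q.+1 * Q.+1 * Q.+1) ?leq_mul//; ring.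
  have lt2 : (m * (d * a * b)) ^ 2 <= 9 * n ^ 2.
    by rewrite (_ : 9 * n ^ 2 = (3 * n) ^ 2) ?leq_exp2r//; ring.
  have := leq_trans lt (leq_trans lt2 HQ).
  by rewrite leq_pmul2l ?expn_gt0 ?m0// leq_exp2r// ltnn.
have [q qE] : exists q, m * (d * a * b) = N1 + gcdn N2 N3 * q.
  have le : N1 <= m * (d * a * b).
    rewrite -(leq_pmul2r c0) (_ : m * (d * a * b) * c = m * d * a * b * c); last by ring.
    by rewrite E -addnA leq_addr.
  have [e eE] : exists e, m * (d * a * b) = N1 + e.
    by exists (m * (d * a * b) - N1); rewrite subnKC.
  have ec : c * e = N2 * b + N3 * a.
    apply: (@addnI (N1 * c)); transitivity (c * (N1 + e)); first by ring.
    by rewrite -eE; transitivity (m * d * a * b * c); [ring|rewrite E; ring].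
  (* The gcd divides [c * e] and is prime to [c], because [c] is prime to [N2]. *)
  have : gcdn N2 N3 %| e.
    have cop : coprime (gcdn N2 N3) c.
      by apply: (@coprime_dvdl _ N2); rewrite ?dvdn_gcdl// coprime_sym.
    by rewrite -(Gauss_dvdr _ cop) ec dvdn_add// dvdn_mulr ?dvdn_gcdl ?dvdn_gcdr.
  by move=> /dvdnP[q qe]; exists q; rewrite eE qe mulnC.
have [r rE] : exists r, m * (d * b * c) = N3 + gcdn N1 N2 * r.
  have le : N3 <= m * (d * b * c).
    rewrite -(leq_pmul2r a0) (_ : m * (d * b * c) * a = m * d * a * b * c); last by ring.
    by rewrite E leq_addl.
  have [e eE] : exists e, m * (d * b * c) = N3 + e.
    by exists (m * (d * b * c) - N3); rewrite subnKC.
  have ea : a * e = N1 * c + N2 * b.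
    apply: (@addnI (N3 * a)); transitivity (a * (N3 + e)); first by ring.
    by rewrite -eE; transitivity (m * d * a * b * c); [ring|rewrite E; ring].
  have : gcdn N1 N2 %| e.
    have cop : coprime (gcdn N1 N2) a.
      by apply: (@coprime_dvdl _ N1); rewrite ?dvdn_gcdl// coprime_sym.
    by rewrite -(Gauss_dvdr _ cop) ea dvdn_add// dvdn_mulr ?dvdn_gcdl ?dvdn_gcdr.
  by move=> /dvdnP[r re]; exists r; rewrite eE re mulnC.
have [/(H4 _ _ _ _ _ _ _ _ S)/(_ qE) ->|qQ] := leqP q Q; first by rewrite !orbT.
have [/(H5 _ _ _ _ _ _ _ _ S)/(_ rE) ->|rQ] := leqP r Q; first by rewrite !orbT.
exfalso.
have eq1 : gcdn N2 N3 * q * c <= 2 * (N2 * b).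
  suff -> : gcdn N2 N3 * q * c = N2 * b + N3 * a by lia.
  apply: (@addnI (N1 * c)); transitivity (c * (N1 + gcdn N2 N3 * q)); first by ring.
  by rewrite -qE; transitivity (m * d * a * b * c); [ring|rewrite E; ring].
have eq2 : gcdn N1 N2 * r * a <= 2 * (N1 * c).
  suff -> : gcdn N1 N2 * r * a = N1 * c + N2 * b by lia.
  apply: (@addnI (N3 * a)); transitivity (a * (N3 + gcdn N1 N2 * r)); first by ring.
  by rewrite -rE; transitivity (m * d * a * b * c); [ring|rewrite E; ring].
have g0 : 0 < gcdn N1 N2 by rewrite gcdn_gt0 N10.
(* The product of [eq1] and [eq2], where [N1 * N2 <= gcdn N1 N2 * n] removes one gcd and the other
   is at least 1. *)
have qra : q * r * a <= 4 * n * b.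
  rewrite -(@leq_pmul2l (gcdn N1 N2 * c)) ?muln_gt0 ?g0//.
  apply: (@leq_trans (gcdn N2 N3 * (gcdn N1 N2 * c * (q * r * a)))).
    by rewrite leq_pmull// gcdn_gt0 N20.
  rewrite (_ : gcdn N2 N3 * (gcdn N1 N2 * c * (q * r * a)) =
    (gcdn N2 N3 * q * c) * (gcdn N1 N2 * r * a)); last by ring.
  apply: leq_trans (leq_mul eq1 eq2) _.
  rewrite (_ : 2 * (N2 * b) * (2 * (N1 * c)) = (N1 * N2) * (4 * b * c)); last by ring.
  rewrite (_ : gcdn N1 N2 * c * (4 * n * b) = gcdn N1 N2 * n * (4 * b * c)); last by ring.
  by rewrite leq_mul// muln_gcd_le.
have lt : m ^ 2 * Q.+1 ^ 5 <= m ^ 2 * ((a * b) * (d * a) * (d * a) * q * r).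
  by rewrite leq_mul// (_ : Q.+1 ^ 5 = Q.+1 * Q.+1 * Q.+1 * Q.+1 * Q.+1) ?leq_mul//; ring.
(* By [qra] the left side is at most [4 * n * (m * t1) ^ 2], and [m * t1 <= 3 * n]. *)
have lt2 : m ^ 2 * ((a * b) * (d * a) * (d * a) * q * r) <= 36 * n ^ 3.
  rewrite (_ : m ^ 2 * ((a * b) * (d * a) * (d * a) * q * r) =
    m ^ 2 * d * d * a * a * b * (q * r * a)); last by ring.
  apply: (@leq_trans (m ^ 2 * d * d * a * a * b * (4 * n * b))); first by rewrite leq_mul.
  rewrite (_ : m ^ 2 * d * d * a * a * b * (4 * n * b) =
    4 * n * (m * (d * a * b)) ^ 2); last by ring.
  rewrite (_ : 36 * n ^ 3 = 4 * n * (3 * n) ^ 2); last by ring.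
  by rewrite leq_mul// leq_exp2r.
have := leq_trans lt (leq_trans lt2 HQ).
by rewrite leq_pmul2l ?expn_gt0 ?m0// leq_exp2r// ltnn.
Qed.

(** * Sums of four unit fractions *)

Definition sol4 (n N1 N2 N3 N4
    x12 x13 x14 x23 x24 x34 x123 x124 x134 x234 x1234 : nat) : seq nat :=
  [:: n * (x12 * x13 * x14 * x123 * x124 * x134 * x1234) %/ N1;
      n * (x12 * x23 * x24 * x123 * x124 * x234 * x1234) %/ N2;
      n * (x13 * x23 * x34 * x123 * x134 * x234 * x1234) %/ N3;
      n * (x14 * x24 * x34 * x124 * x134 * x234 * x1234) %/ N4].

(** The equation is that of [reduced_equation4] divided by the product of the [x_I ^ (|I| - 1)]: on
    the left each [x_I] remains once, and next to [N_i] those with [i] outside [I]. *)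
Record system4 (A m n N1 N2 N3 N4
    x12 x13 x14 x23 x24 x34 x123 x124 x134 x234 x1234 : nat) : Prop := System4 {
  sys4_gt0 : [/\ 0 < N1, 0 < N2, 0 < N3 & 0 < N4] /\
    [/\ [/\ 0 < x12, 0 < x13 & 0 < x14], [/\ 0 < x23, 0 < x24 & 0 < x34],
        [/\ 0 < x123, 0 < x124, 0 < x134 & 0 < x234] & 0 < x1234];
  sys4_le : [/\ N1 <= A, N2 <= A, N3 <= A & N4 <= A] /\
    [/\ [/\ x12 <= A, x13 <= A & x14 <= A], [/\ x23 <= A, x24 <= A & x34 <= A],
        [/\ x123 <= A, x124 <= A, x134 <= A & x234 <= A] & x1234 <= A];
  sys4_dvd : [/\ N1 %| n, N2 %| n, N3 %| n & N4 %| n];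
  sys4_coprime : coprime x14 x23;
  sys4_eq :
    m * (x12 * x13 * x14 * x23 * x24 * x34 * x123 * x124 * x134 * x234 * x1234) =
      N1 * (x23 * x24 * x34 * x234) + N2 * (x13 * x14 * x34 * x134) +
      N3 * (x12 * x14 * x24 * x124) + N4 * (x12 * x13 * x23 * x123) }.

Ltac unpack4 S :=
  have [[N10 N20 N30 N40] [[x120 x130 x140] [x230 x240 x340]
    [x1230 x1240 x1340 x2340] x12340]] := sys4_gt0 S;
  have [[N1A N2A N3A N4A] [[x12A x13A x14A] [x23A x24A x34A]
    [x123A x124A x134A x234A] x1234A]] := sys4_le S;
  have [N1n N2n N3n N4n] := sys4_dvd S; have E := sys4_eq S.

Ltac posn :=
  repeat (rewrite addn_gt0; apply/orP; left);
  rewrite ?muln_gt0; repeat (apply/andP; split); assumption.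

Section Codes4.
Variables (A D m n Q : nat).
Hypotheses (A1 : 1 < A) (m0 : 0 < m) (n0 : 0 < n) (mA : m <= A) (nA : n <= A).
Hypothesis HD : few_divisors A D.
Let B := A ^ 100.

(** The value of [j] gives [t1], whose divisors supply all [x_I] with 1 in [I]. With [x23] and
    [x234] also known, the equation is bilinear in [x24] and [x34]. *)
Lemma cover4_first : exists L : seq (seq nat), size L <= Q * D ^ 13 /\
  forall N1 N2 N3 N4 x12 x13 x14 x23 x24 x34 x123 x124 x134 x234 x1234 j,
    system4 A m n N1 N2 N3 N4
      x12 x13 x14 x23 x24 x34 x123 x124 x134 x234 x1234 ->
    0 < j -> x12 * x13 * x14 * x123 * x124 * x134 * x1234 = N1 %/ m + j ->
    j * (x23 * x234) <= Q ->
    sol4 n N1 N2 N3 N4 x12 x13 x14 x23 x24 x34 x123 x124 x134 x234 x1234 \in L.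
Proof.
exists (bind (iota 1 Q) (fun q => bind (dv B n) (fun N1 => bind (dv B n) (fun N2 =>
  bind (dv B n) (fun N3 => bind (dv B n) (fun N4 =>
  bind (dv B q) (fun j => bind (dv B (q %/ j)) (fun x23 =>
  let x234 := q %/ j %/ x23 in let t := N1 %/ m + j in
  bind (dv B t) (fun x12 => bind (dv B t) (fun x13 => bind (dv B t) (fun x14 =>
  bind (dv B t) (fun x123 => bind (dv B t) (fun x124 => bind (dv B t) (fun x134 =>
  let x1234 := t %/ (x12 * x13 * x14 * x123 * x124 * x134) in
  [seq sol4 n N1 N2 N3 N4
      x12 x13 x14 x23 x.1 x.2 x123 x124 x134 x234 x1234
    | x <- bilinear B (x23 * x234 * (m * t - N1)) (N3 * (x12 * x14 * x124))
             (N2 * (x13 * x14 * x134)) (N4 * (x12 * x13 * x23 * x123))])))))))))))))).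
split; first by size_cover HD.
move=> N1 N2 N3 N4 x12 x13 x14 x23 x24 x34 x123 x124 x134 x234 x1234 j S j0 tE qQ.
unpack4 S; set t := _ * x1234 in tE.
have t0 : 0 < t by rewrite /t; posn.
have tB : t <= B by rewrite /t; expn_bound A1.
have jt : j <= t by rewrite tE leq_addl.
have jA : j <= A ^ 7 by apply: leq_trans jt _; rewrite /t; expn_bound A1.
apply: (@mem_bind _ _ (j * (x23 * x234))); first by rewrite mem_iota1//; posn.
apply: (@mem_bind _ _ N1); first by apply: mem_dv => //; expn_bound A1.
apply: (@mem_bind _ _ N2); first by apply: mem_dv => //; expn_bound A1.
apply: (@mem_bind _ _ N3); first by apply: mem_dv => //; expn_bound A1.
apply: (@mem_bind _ _ N4); first by apply: mem_dv => //; expn_bound A1.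
apply: (@mem_bind _ _ j).
  by apply: mem_dv; [expn_bound A1|posn|exact: dvdn_mulr].
rewrite mulKn//; apply: (@mem_bind _ _ x23).
  by apply: mem_dv; [expn_bound A1|posn|exact: dvdn_mulr].
rewrite /= mulKn// -tE.
have dvt y z : t = y * z -> y \in dv B t.
  by move=> tyz; apply: mem_dv => //; rewrite tyz dvdn_mulr.
apply: (@mem_bind _ _ x12).
  by apply: (dvt _ (x13 * x14 * x123 * x124 * x134 * x1234)); rewrite /t; ring.
apply: (@mem_bind _ _ x13).
  by apply: (dvt _ (x12 * x14 * x123 * x124 * x134 * x1234)); rewrite /t; ring.
apply: (@mem_bind _ _ x14).
  by apply: (dvt _ (x12 * x13 * x123 * x124 * x134 * x1234)); rewrite /t; ring.
apply: (@mem_bind _ _ x123).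
  by apply: (dvt _ (x12 * x13 * x14 * x124 * x134 * x1234)); rewrite /t; ring.
apply: (@mem_bind _ _ x124).
  by apply: (dvt _ (x12 * x13 * x14 * x123 * x134 * x1234)); rewrite /t; ring.
apply: (@mem_bind _ _ x134).
  by apply: (dvt _ (x12 * x13 * x14 * x123 * x124 * x1234)); rewrite /t; ring.
have -> : t %/ (x12 * x13 * x14 * x123 * x124 * x134) = x1234.
  by rewrite /t mulKn//; posn.
have [e eE] : exists e, m * t = N1 + e.
  exists (m * t - N1); rewrite subnKC// tE mulnDr {1}(divn_eq N1 m) mulnC.
  by rewrite leq_add2l ltnW// (leq_trans (ltn_pmod _ m0))// leq_pmulr.
have eA : e <= A ^ 8.
  by apply: (@leq_trans (m * t)); [rewrite eE leq_addl|rewrite /t; expn_bound A1].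
rewrite eE addKn; apply/mapP; exists (x24, x34) => //.
apply: mem_bilinear; [posn|posn|posn|posn|by expn_bound A1|].
apply: (@addnI (N1 * (x23 * x24 * x34 * x234))).
transitivity ((N1 + e) * (x23 * x24 * x34 * x234)); first by ring.
rewrite -eE /t; transitivity (m * (x12 * x13 * x14 * x23 * x24 * x34 *
      x123 * x124 * x134 * x234 * x1234)); first by ring.
by rewrite E; ring.
Qed.

(** Let [k = x12 * x123 * x124 * x1234]. Divided by [x34], the equation reads
    [m * k * p * q = N2 * p + N1 * q + z] with [p = x13 * x14 * x134] and [q = x23 * x24 * x234]. It
    is bilinear in [p] and [q], whose divisors give the remaining factors; [x34] then follows from
    [z]. *)
Lemma cover4_second : exists L : seq (seq nat), size L <= Q * D ^ 13 /\
  forall N1 N2 N3 N4 x12 x13 x14 x23 x24 x34 x123 x124 x134 x234 x1234 z,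
    system4 A m n N1 N2 N3 N4
      x12 x13 x14 x23 x24 x34 x123 x124 x134 x234 x1234 ->
    z * x34 = N3 * (x12 * x14 * x24 * x124) + N4 * (x12 * x13 * x23 * x123) ->
    x12 * x123 * x124 * x1234 * z <= Q ->
    sol4 n N1 N2 N3 N4 x12 x13 x14 x23 x24 x34 x123 x124 x134 x234 x1234 \in L.
Proof.
exists (bind (iota 1 Q) (fun q => bind (dv B n) (fun N1 => bind (dv B n) (fun N2 =>
  bind (dv B n) (fun N3 => bind (dv B n) (fun N4 =>
  bind (dv B q) (fun k => let z := q %/ k in
  bind (dv B k) (fun x12 => bind (dv B k) (fun x123 => bind (dv B k) (fun x124 =>
  let x1234 := k %/ (x12 * x123 * x124) in
  bind (bilinear B (m * k) N2 N1 z) (fun p =>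
  bind (dv B p.1) (fun x13 => bind (dv B p.1) (fun x14 =>
  let x134 := p.1 %/ (x13 * x14) in
  bind (dv B p.2) (fun x23 => bind (dv B p.2) (fun x24 =>
  let x234 := p.2 %/ (x23 * x24) in
  let x34 := (N3 * (x12 * x14 * x24 * x124) + N4 * (x12 * x13 * x23 * x123)) %/ z in
  [:: sol4 n N1 N2 N3 N4
      x12 x13 x14 x23 x24 x34 x123 x124 x134 x234 x1234]))))))))))))))).
split.
  apply: size_bind; [by rewrite size_iota | move=> q].
  do 8! (apply: size_bind_dv => // ?); rewrite expnS.
  apply: size_bind => [|p]; first exact: size_bilinear.
  by do 4! (apply: size_bind_dv => // ?).
move=> N1 N2 N3 N4 x12 x13 x14 x23 x24 x34 x123 x124 x134 x234 x1234 z S zE qQ.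
unpack4 S; set k := x12 * x123 * x124 * x1234 in qQ.
have zx0 : 0 < z * x34 by rewrite zE; posn.
have z0 : 0 < z by case: z zx0 {zE qQ}.
have zA : z <= A ^ 11.
  by apply: (@leq_trans (z * x34)); [rewrite leq_pmulr|rewrite zE; expn_bound A1].
have k0 : 0 < k by rewrite /k; posn.
have kB : k <= B by rewrite /k; expn_bound A1.
apply: (@mem_bind _ _ (k * z)); first by rewrite mem_iota1//; posn.
apply: (@mem_bind _ _ N1); first by apply: mem_dv => //; expn_bound A1.
apply: (@mem_bind _ _ N2); first by apply: mem_dv => //; expn_bound A1.
apply: (@mem_bind _ _ N3); first by apply: mem_dv => //; expn_bound A1.
apply: (@mem_bind _ _ N4); first by apply: mem_dv => //; expn_bound A1.
apply: (@mem_bind _ _ k).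
  by apply: mem_dv; [rewrite /k; expn_bound A1|posn|exact: dvdn_mulr].
rewrite mulKn//.
have dvk y u : k = y * u -> y \in dv B k.
  by move=> kyu; apply: mem_dv => //; rewrite kyu dvdn_mulr.
apply: (@mem_bind _ _ x12).
  by apply: (dvk _ (x123 * x124 * x1234)); rewrite /k; ring.
apply: (@mem_bind _ _ x123).
  by apply: (dvk _ (x12 * x124 * x1234)); rewrite /k; ring.
apply: (@mem_bind _ _ x124).
  by apply: (dvk _ (x12 * x123 * x1234)); rewrite /k; ring.
apply: (@mem_bind _ _ (x13 * x14 * x134, x23 * x24 * x234)).
  apply: mem_bilinear; [posn|posn|posn|posn|by rewrite /k; expn_bound A1|].
  apply/eqP; rewrite -(eqn_pmul2r x340); apply/eqP.
  transitivity (m * (x12 * x13 * x14 * x23 * x24 * x34 *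
      x123 * x124 * x134 * x234 * x1234)); first by rewrite /k; ring.
  by rewrite E -addnA -zE; ring.
apply: (@mem_bind _ _ x13).
  by apply: mem_dv; [expn_bound A1|posn|rewrite /= -mulnA dvdn_mulr].
apply: (@mem_bind _ _ x14).
  by apply: mem_dv; [expn_bound A1|posn|rewrite /= mulnAC dvdn_mull].
apply: (@mem_bind _ _ x23).
  by apply: mem_dv; [expn_bound A1|posn|rewrite /= -mulnA dvdn_mulr].
apply: (@mem_bind _ _ x24).
  by apply: mem_dv; [expn_bound A1|posn|rewrite /= mulnAC dvdn_mull].
have -> : k %/ (x12 * x123 * x124) = x1234 by rewrite /k mulKn//; posn.
have -> : (x13 * x14 * x134) %/ (x13 * x14) = x134 by rewrite mulKn//; posn.
have -> : (x23 * x24 * x234) %/ (x23 * x24) = x234 by rewrite mulKn//; posn.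
by rewrite -zE mulKn// mem_seq1.
Qed.

(** The code leaves out [x14], [x23] and [x234]. Modulo [x23] the equation says that [x23] divides
    [x14 * F], hence [F] by coprimality; what is left is bilinear in [x14] and [x234]. *)
Lemma cover4_third : exists L : seq (seq nat), size L <= Q * D ^ 13 /\
  forall N1 N2 N3 N4 x12 x13 x14 x23 x24 x34 x123 x124 x134 x234 x1234,
    system4 A m n N1 N2 N3 N4
      x12 x13 x14 x23 x24 x34 x123 x124 x134 x234 x1234 ->
    x12 * x24 * x124 * x13 * x34 * x134 * x123 * x1234 <= Q ->
    sol4 n N1 N2 N3 N4 x12 x13 x14 x23 x24 x34 x123 x124 x134 x234 x1234 \in L.
Proof.
exists (bind (iota 1 Q) (fun q => bind (dv B n) (fun N1 => bind (dv B n) (fun N2 =>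
  bind (dv B n) (fun N3 => bind (dv B n) (fun N4 =>
  bind (dv B q) (fun x12 => bind (dv B q) (fun x24 => bind (dv B q) (fun x124 =>
  bind (dv B q) (fun x13 => bind (dv B q) (fun x34 => bind (dv B q) (fun x134 =>
  bind (dv B q) (fun x123 =>
  let x1234 := q %/ (x12 * x24 * x124 * x13 * x34 * x134 * x123) in
  let F := N2 * (x13 * x34 * x134) + N3 * (x12 * x24 * x124) in
  bind (dv B F) (fun x23 =>
  [seq sol4 n N1 N2 N3 N4
      x12 x13 x.1 x23 x24 x34 x123 x124 x134 x.2 x1234
    | x <- bilinear B (m * (x12 * x13 * x23 * x24 * x34 * x123 * x124 * x134 * x1234))
             F (N1 * (x23 * x24 * x34)) (N4 * (x12 * x13 * x23 * x123))])))))))))))))).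
split; first by size_cover HD.
move=> N1 N2 N3 N4 x12 x13 x14 x23 x24 x34 x123 x124 x134 x234 x1234 S qQ.
unpack4 S; set q := _ * x1234 in qQ.
have q0 : 0 < q by rewrite /q; posn.
have qB : q <= B by rewrite /q; expn_bound A1.
have dvq y u : q = y * u -> y \in dv B q.
  by move=> qyu; apply: mem_dv => //; rewrite qyu dvdn_mulr.
apply: (@mem_bind _ _ q); first exact: mem_iota1.
apply: (@mem_bind _ _ N1); first by apply: mem_dv => //; expn_bound A1.
apply: (@mem_bind _ _ N2); first by apply: mem_dv => //; expn_bound A1.
apply: (@mem_bind _ _ N3); first by apply: mem_dv => //; expn_bound A1.
apply: (@mem_bind _ _ N4); first by apply: mem_dv => //; expn_bound A1.
apply: (@mem_bind _ _ x12).
  by apply: (dvq _ (x24 * x124 * x13 * x34 * x134 * x123 * x1234)); rewrite /q; ring.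
apply: (@mem_bind _ _ x24).
  by apply: (dvq _ (x12 * x124 * x13 * x34 * x134 * x123 * x1234)); rewrite /q; ring.
apply: (@mem_bind _ _ x124).
  by apply: (dvq _ (x12 * x24 * x13 * x34 * x134 * x123 * x1234)); rewrite /q; ring.
apply: (@mem_bind _ _ x13).
  by apply: (dvq _ (x12 * x24 * x124 * x34 * x134 * x123 * x1234)); rewrite /q; ring.
apply: (@mem_bind _ _ x34).
  by apply: (dvq _ (x12 * x24 * x124 * x13 * x134 * x123 * x1234)); rewrite /q; ring.
apply: (@mem_bind _ _ x134).
  by apply: (dvq _ (x12 * x24 * x124 * x13 * x34 * x123 * x1234)); rewrite /q; ring.
apply: (@mem_bind _ _ x123).
  by apply: (dvq _ (x12 * x24 * x124 * x13 * x34 * x134 * x1234)); rewrite /q; ring.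
have -> : q %/ (x12 * x24 * x124 * x13 * x34 * x134 * x123) = x1234.
  by rewrite /q mulKn//; posn.
apply: (@mem_bind _ _ x23).
  apply: mem_dv; [by expn_bound A1|by posn|].
  have cop : coprime x23 x14 by rewrite coprime_sym (sys4_coprime S).
  rewrite -(Gauss_dvdr _ cop).
  rewrite -(dvdn_addr (m := N1 * (x23 * x24 * x34 * x234) + N4 * (x12 * x13 * x23 * x123))).
    apply/dvdnP; exists (m * (x12 * x13 * x14 * x24 * x34 * x123 * x124 * x134 * x234 * x1234)).
    transitivity (m * (x12 * x13 * x14 * x23 * x24 * x34 *
      x123 * x124 * x134 * x234 * x1234)); last by ring.
    by rewrite E; ring.
  apply/dvdnP; exists (N1 * (x24 * x34 * x234) + N4 * (x12 * x13 * x123)); ring.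
apply/mapP; exists (x14, x234) => //.
apply: mem_bilinear; [posn|posn|posn|posn|by expn_bound A1|].
transitivity (m * (x12 * x13 * x14 * x23 * x24 * x34 *
      x123 * x124 * x134 * x234 * x1234)); first by ring.
by rewrite E; ring.
Qed.

End Codes4.

Lemma leq_factor (y t u A : nat) : t = y * u -> 0 < t -> t <= A -> 0 < y /\ y <= A.
Proof.
move=> -> ; rewrite muln_gt0 => /andP[y0 u0] yuA; split=> //.
by apply: leq_trans yuA; rewrite leq_pmulr.
Qed.

Lemma exists_system4 (A m n a1 a2 a3 a4 : nat) :
  0 < n -> n <= A -> 0 < a1 -> 0 < a2 -> 0 < a3 -> 0 < a4 ->
  a1 <= A -> a2 <= A -> a3 <= A -> a4 <= A ->
  m * a1 * a2 * a3 * a4 =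
    n * (a2 * a3 * a4 + a1 * a3 * a4 + a1 * a2 * a4 + a1 * a2 * a3) ->
  exists N1 N2 N3 N4 x12 x13 x14 x23 x24 x34 x123 x124 x134 x234 x1234,
  [/\ system4 A m n N1 N2 N3 N4
        x12 x13 x14 x23 x24 x34 x123 x124 x134 x234 x1234,
    a1 * N1 = n * (x12 * x13 * x14 * x123 * x124 * x134 * x1234),
    a2 * N2 = n * (x12 * x23 * x24 * x123 * x124 * x234 * x1234),
    a3 * N3 = n * (x13 * x23 * x34 * x123 * x134 * x234 * x1234)
    & a4 * N4 = n * (x14 * x24 * x34 * x124 * x134 * x234 * x1234)].
Proof.
move=> n0 nA a10 a20 a30 a40 a1A a2A a3A a4A E.
have [N1 [t1 [N10 t10 N1n E1 co1]]] := reduced_denominator a10 n0.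
have [N2 [t2 [N20 t20 N2n E2 co2]]] := reduced_denominator a20 n0.
have [N3 [t3 [N30 t30 N3n E3 co3]]] := reduced_denominator a30 n0.
have [N4 [t4 [N40 t40 N4n E4 co4]]] := reduced_denominator a40 n0.
have Et := reduced_equation4 n0 E1 E2 E3 E4 E.
have d1 := dvdn_lcm_of_equation4 t20 t30 t40 co1 Et.
have d2 : t2 %| lcmn t1 (lcmn t3 t4).
  apply: (@dvdn_lcm_of_equation4 m N2 N1 N3 N4) => //.
  by transitivity (m * t1 * t2 * t3 * t4); [ring|rewrite Et; ring].
have d3 : t3 %| lcmn t1 (lcmn t2 t4).
  apply: (@dvdn_lcm_of_equation4 m N3 N1 N2 N4) => //.
  by transitivity (m * t1 * t2 * t3 * t4); [ring|rewrite Et; ring].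
have d4 : t4 %| lcmn t1 (lcmn t2 t3).
  apply: (@dvdn_lcm_of_equation4 m N4 N1 N2 N3) => //.
  by transitivity (m * t1 * t2 * t3 * t4); [ring|rewrite Et; ring].
have [x12 [x13 [x14 [x23 [x24 [x34 [x123 [x124 [x134 [x234 [x1234
  [T1 T2 T3 T4 cop]]]]]]]]]]]] := relative_gcd4 t10 t20 t30 t40 d1 d2 d3 d4.
have t1A := leq_trans (numerator_le n0 N1n E1) a1A.
have t2A := leq_trans (numerator_le n0 N2n E2) a2A.
have t3A := leq_trans (numerator_le n0 N3n E3) a3A.
have t4A := leq_trans (numerator_le n0 N4n E4) a4A.
have [p12 l12] : 0 < x12 /\ x12 <= A.
  by apply: (@leq_factor _ t1 (x13 * x14 * x123 * x124 * x134 * x1234)) => //; rewrite T1; ring.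
have [p13 l13] : 0 < x13 /\ x13 <= A.
  by apply: (@leq_factor _ t1 (x12 * x14 * x123 * x124 * x134 * x1234)) => //; rewrite T1; ring.
have [p14 l14] : 0 < x14 /\ x14 <= A.
  by apply: (@leq_factor _ t1 (x12 * x13 * x123 * x124 * x134 * x1234)) => //; rewrite T1; ring.
have [p123 l123] : 0 < x123 /\ x123 <= A.
  by apply: (@leq_factor _ t1 (x12 * x13 * x14 * x124 * x134 * x1234)) => //; rewrite T1; ring.
have [p124 l124] : 0 < x124 /\ x124 <= A.
  by apply: (@leq_factor _ t1 (x12 * x13 * x14 * x123 * x134 * x1234)) => //; rewrite T1; ring.
have [p134 l134] : 0 < x134 /\ x134 <= A.
  by apply: (@leq_factor _ t1 (x12 * x13 * x14 * x123 * x124 * x1234)) => //; rewrite T1; ring.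
have [p1234 l1234] : 0 < x1234 /\ x1234 <= A.
  by apply: (@leq_factor _ t1 (x12 * x13 * x14 * x123 * x124 * x134)) => //; rewrite T1; ring.
have [p23 l23] : 0 < x23 /\ x23 <= A.
  by apply: (@leq_factor _ t2 (x12 * x24 * x123 * x124 * x234 * x1234)) => //; rewrite T2; ring.
have [p24 l24] : 0 < x24 /\ x24 <= A.
  by apply: (@leq_factor _ t2 (x12 * x23 * x123 * x124 * x234 * x1234)) => //; rewrite T2; ring.
have [p234 l234] : 0 < x234 /\ x234 <= A.
  by apply: (@leq_factor _ t2 (x12 * x23 * x24 * x123 * x124 * x1234)) => //; rewrite T2; ring.
have [p34 l34] : 0 < x34 /\ x34 <= A.
  by apply: (@leq_factor _ t3 (x13 * x23 * x123 * x134 * x234 * x1234)) => //; rewrite T3; ring.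
exists N1, N2, N3, N4, x12, x13, x14, x23, x24, x34, x123, x124, x134, x234, x1234.
rewrite -T1 -T2 -T3 -T4; split=> //; split=> //.
- by split; [split; apply: leq_trans nA; apply: dvdn_leq|].
- apply/eqP; rewrite -(@eqn_pmul2l (x12 * x13 * x14 * x23 * x24 * x34
    * x123 ^ 2 * x124 ^ 2 * x134 ^ 2 * x234 ^ 2 * x1234 ^ 3)).
    apply/eqP; transitivity (m * t1 * t2 * t3 * t4); first by rewrite T1 T2 T3 T4; ring.
    by rewrite Et T1 T2 T3 T4; ring.
  by rewrite !muln_gt0 ?p12 p13 p14 p23 p24 p34 p123 p124 p134 p234 p1234.
Qed.

Lemma sol4E (n a1 a2 a3 a4 N1 N2 N3 N4
    x12 x13 x14 x23 x24 x34 x123 x124 x134 x234 x1234 : nat) :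
  0 < N1 -> 0 < N2 -> 0 < N3 -> 0 < N4 ->
  a1 * N1 = n * (x12 * x13 * x14 * x123 * x124 * x134 * x1234) ->
  a2 * N2 = n * (x12 * x23 * x24 * x123 * x124 * x234 * x1234) ->
  a3 * N3 = n * (x13 * x23 * x34 * x123 * x134 * x234 * x1234) ->
  a4 * N4 = n * (x14 * x24 * x34 * x124 * x134 * x234 * x1234) ->
  sol4 n N1 N2 N3 N4 x12 x13 x14 x23 x24 x34 x123 x124 x134 x234 x1234 =
    [:: a1; a2; a3; a4].
Proof. by move=> N10 N20 N30 N40; rewrite /sol4 => <- <- <- <-; rewrite !mulnK. Qed.

Lemma bind_exists (S T : eqType) (s : seq S) (k : nat) (R : S -> T -> Prop) :
  (forall x, exists L : seq T, size L <= k /\ forall y, R x y -> y \in L) ->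
  exists L : seq T, size L <= size s * k /\
    forall x y, x \in s -> R x y -> y \in L.
Proof.
move=> H; elim: s => [|x s [L [sL HL]]]; first by exists [::].
have [L' [sL' HL']] := H x; exists (L' ++ L); split.
  by rewrite size_cat mulSn leq_add.
move=> x' y; rewrite inE mem_cat => /orP[/eqP-> /HL'->//|x's Rxy].
by rewrite (HL _ _ x's Rxy) orbT.
Qed.

(* Here the reduced numerator of [1 / a1] forces [a1], so that only
   [m / n - 1 / a1] as a sum of three unit fractions has to be counted. *)
Lemma cover4_single (A D m n Q : nat) : 1 < A -> 0 < m -> 0 < n ->
  n <= A -> 4 * n ^ 2 <= A -> few_divisors A D ->
  (2304 * n ^ 6 <= m ^ 3 * Q ^ 5) || (144 * n ^ 4 <= m ^ 2 * Q ^ 3) ->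
  exists L : seq (seq nat), size L <= D * (5 * (Q * D ^ 5)) /\
    forall a1 a2 a3 a4 N1, N1 %| n -> a1 * N1 = n * (N1 %/ m).+1 ->
      0 < a1 -> a1 <= a2 -> a2 <= a3 -> a3 <= a4 -> a4 <= A ->
      n < m * a1 -> m * a1 <= 4 * n ->
      m * a1 * a2 * a3 * a4 =
        n * (a2 * a3 * a4 + a1 * a3 * a4 + a1 * a2 * a4 + a1 * a2 * a3) ->
      [:: a1; a2; a3; a4] \in L.
Proof.
move=> A1 m0 n0 nA n2A HD HQ.
pose R N1 y := exists a1 a2 a3 a4, y = [:: a1; a2; a3; a4] /\
  [/\ a1 * N1 = n * (N1 %/ m).+1, 0 < N1, 0 < a1, a1 <= a2 & a2 <= a3] /\
  [/\ a3 <= a4, a4 <= A, n < m * a1, m * a1 <= 4 * n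
  & m * a1 * a2 * a3 * a4 =
    n * (a2 * a3 * a4 + a1 * a3 * a4 + a1 * a2 * a4 + a1 * a2 * a3)].
suff H N1 : exists L : seq (seq nat), size L <= 5 * (Q * D ^ 5) /\
    forall y, R N1 y -> y \in L.
  have [L [sL HL]] := bind_exists (divisors n) H.
  exists L; split.
    apply: leq_trans sL _; rewrite leq_mul//; apply: HD; expn_bound A1.
  move=> a1 a2 a3 a4 N1 N1n *; apply: (HL N1); first by rewrite -dvdn_divisors.
  by exists a1, a2, a3, a4; split=> //; split; split=> //; apply: dvdn_gt0 n0 N1n.
pose a := n * (N1 %/ m).+1 %/ N1.
(* A candidate [a] outside this range comes from no solution, so the empty list suffices. *)
have [/andP[lo hi]|no] := boolP ((n < m * a) && (m * a <= 4 * n)); last first.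
  exists [::]; split=> // y [a1 [a2 [a3 [a4 [_ [[E1 N10 _ _ _] [_ _ lo hi _]]]]]]].
  by move: no; rewrite /a -E1 mulnK// lo hi.
have a0 : 0 < a by case: (a) lo => //; rewrite muln0.
have u0 : 0 < m * a - n by rewrite subn_gt0.
have an : a <= 4 * n by apply: leq_trans hi; rewrite leq_pmull.
have naA : n * a <= A.
  by apply: leq_trans n2A; rewrite (_ : 4 * n ^ 2 = n * (4 * n)) ?leq_mul//; ring.
have uA : m * a - n <= A.
  by apply: leq_trans n2A; rewrite (leq_trans (leq_subr _ _))// (leq_trans hi)//
    leq_mul// leq_pmulr.
have na0 : 0 < n * a by rewrite muln_gt0 n0.
(* The remaining fraction is [(m * a - n) / (n * a)], whose numerator is at least 1. By
   [m * a <= 4 * n] the constants become [36 * 4 ^ 3 = 2304] and [9 * 4 ^ 2 = 144]. *)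
have HQ' : (36 * (n * a) ^ 3 <= (m * a - n) ^ 2 * Q ^ 5)
    || (9 * (n * a) ^ 2 <= (m * a - n) ^ 2 * Q ^ 3).
  have u2 : 0 < (m * a - n) ^ 2 by rewrite expn_gt0 u0.
  case/orP: HQ => HQ; apply/orP; [left|right].
    apply: (@leq_trans (Q ^ 5)); last by rewrite leq_pmull.
    rewrite -(@leq_pmul2l (m ^ 3)) ?expn_gt0 ?m0//; apply: leq_trans HQ.
    rewrite (_ : m ^ 3 * (36 * (n * a) ^ 3) = 36 * n ^ 3 * (m * a) ^ 3); last by ring.
    rewrite (_ : 2304 * n ^ 6 = 36 * n ^ 3 * (4 * n) ^ 3); last by ring.
    by rewrite leq_mul// leq_exp2r.
  apply: (@leq_trans (Q ^ 3)); last by rewrite leq_pmull.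
  rewrite -(@leq_pmul2l (m ^ 2)) ?expn_gt0 ?m0//; apply: leq_trans HQ.
  rewrite (_ : m ^ 2 * (9 * (n * a) ^ 2) = 9 * n ^ 2 * (m * a) ^ 2); last by ring.
  rewrite (_ : 144 * n ^ 4 = 9 * n ^ 2 * (4 * n) ^ 2); last by ring.
  by rewrite leq_mul// leq_exp2r.
have [L [sL HL]] := cover3 A1 u0 na0 uA naA HD HQ'.
exists (map (cons a) L); split; first by rewrite size_map.
move=> y [a1 [a2 [a3 [a4 [-> [[E1 N10 a10 a12 a23] [a34 a4A _ _ E]]]]]]].
have aE : a1 = a by rewrite /a -E1 mulnK.
rewrite aE in a10 a12 E *.
apply: map_f; apply: HL => //; first exact: leq_trans a12.
apply: (@addnI (n * a2 * a3 * a4)).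
transitivity ((n + (m * a - n)) * a2 * a3 * a4); first by ring.
by rewrite subnKC ?(ltnW lo)// E; ring.
Qed.

(** [Q] bounds the codes in the case [j >= 2], and [Q'] the three fraction codes in the case
    [j = 1]. *)
Lemma cover4 (A D m n Q Q' : nat) : 1 < A -> 0 < m -> 0 < n -> m <= A ->
  n <= A -> 4 * n ^ 2 <= A -> few_divisors A D ->
  4608 * n ^ 6 <= m ^ 5 * Q ^ 4 ->
  (2304 * n ^ 6 <= m ^ 3 * Q' ^ 5) || (144 * n ^ 4 <= m ^ 2 * Q' ^ 3) ->
  exists L : seq (seq nat),
    size L <= 3 * (Q * D ^ 13) + D * (5 * (Q' * D ^ 5)) /\
    forall a1 a2 a3 a4,
      0 < a1 -> a1 <= a2 -> a2 <= a3 -> a3 <= a4 -> a4 <= A ->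
      m * a1 * a2 * a3 * a4 =
        n * (a2 * a3 * a4 + a1 * a3 * a4 + a1 * a2 * a4 + a1 * a2 * a3) ->
      [:: a1; a2; a3; a4] \in L.
Proof.
move=> A1 m0 n0 mA nA n2A HD HQ HQ'.
have [L0 [s0 H0]] := cover4_single A1 m0 n0 nA n2A HD HQ'.
have [L1 [s1 H1]] := cover4_first Q A1 m0 n0 mA nA HD.
have [L2 [s2 H2]] := cover4_second Q A1 n0 mA nA HD.
have [L3 [s3 H3]] := cover4_third Q A1 n0 mA nA HD.
exists (L1 ++ L2 ++ L3 ++ L0); split; first by rewrite !size_cat; lia.
move=> a1 a2 a3 a4 a10 a12 a23 a34 a4A Ea.
have a20 : 0 < a2 := leq_trans a10 a12.
have a30 : 0 < a3 := leq_trans a20 a23.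
have a40 : 0 < a4 := leq_trans a30 a34.
have a3A := leq_trans a34 a4A.
have a2A := leq_trans a23 a3A.
have a1A := leq_trans a12 a2A.
have [N1 [N2 [N3 [N4 [x12 [x13 [x14 [x23 [x24 [x34 [x123 [x124 [x134 [x234
  [x1234 [S E1 E2 E3 E4]]]]]]]]]]]]]]]] :=
  exists_system4 n0 nA a10 a20 a30 a40 a1A a2A a3A a4A Ea.
unpack4 S.
have [N1n' N2n' N3n'] : [/\ N1 <= n, N2 <= n & N3 <= n] by split; apply: dvdn_leq.
(* The order of the [a_i] makes the four summands decrease, [T1] being the largest. *)
have le12 : N2 * (x13 * x14 * x134) <= N1 * (x23 * x24 * x234).
  apply: (@term_le n a1 a2 N1 N2 (x12 * x123 * x124 * x1234)) => //; first posn.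
    by rewrite E1; ring.
  by rewrite E2; ring.
have le23 : N3 * (x12 * x24 * x124) <= N2 * (x13 * x34 * x134).
  apply: (@term_le n a2 a3 N2 N3 (x23 * x123 * x234 * x1234)) => //; first posn.
    by rewrite E2; ring.
  by rewrite E3; ring.
have le34 : N4 * (x13 * x23 * x123) <= N3 * (x14 * x24 * x124).
  apply: (@term_le n a3 a4 N3 N4 (x34 * x134 * x234 * x1234)) => //; first posn.
    by rewrite E3; ring.
  by rewrite E4; ring.
set T1 := N1 * (x23 * x24 * x34 * x234) in E.
set T2 := N2 * (x13 * x14 * x34 * x134) in E.
set T3 := N3 * (x12 * x14 * x24 * x124) in E.
set T4 := N4 * (x12 * x13 * x23 * x123) in E.
have T21 : T2 <= T1.
  rewrite (_ : T2 = N2 * (x13 * x14 * x134) * x34); last by rewrite /T2; ring.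
  rewrite (_ : T1 = N1 * (x23 * x24 * x234) * x34); last by rewrite /T1; ring.
  by rewrite leq_mul.
have T32 : T3 <= T2.
  rewrite (_ : T3 = N3 * (x12 * x24 * x124) * x14); last by rewrite /T3; ring.
  rewrite (_ : T2 = N2 * (x13 * x34 * x134) * x14); last by rewrite /T2; ring.
  by rewrite leq_mul.
have T43 : T4 <= T3.
  rewrite (_ : T4 = N4 * (x13 * x23 * x123) * x12); last by rewrite /T4; ring.
  rewrite (_ : T3 = N3 * (x14 * x24 * x124) * x12); last by rewrite /T3; ring.
  by rewrite leq_mul.
have T20 : 0 < T2 by rewrite /T2; posn.
set t := x12 * x13 * x14 * x123 * x124 * x134 * x1234 in E1.
have t0 : 0 < t by rewrite /t; posn.
pose w := x23 * x24 * x34 * x234; have T1E : T1 = N1 * w by [].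
have w0 : 0 < w by rewrite /w; posn.
have mtw : m * t * w = T1 + T2 + T3 + T4 by rewrite -E /t /w; ring.
have Nt : N1 < m * t.
  by rewrite -(ltn_pmul2r w0) mtw T1E -!addnA -[ltnLHS]addn0 ltn_add2l addn_gt0 T20.
have tN : m * t <= 4 * N1.
  rewrite -(leq_pmul2r w0) mtw -mulnA -T1E; clear -T21 T32 T43; lia.
rewrite -(sol4E N10 N20 N30 N40 E1 E2 E3 E4) !mem_cat.
(* [m * t > N1] rules out [t <= N1 %/ m]; equality is the case [j = 1]. *)
have [j0 | j1 | jE] := ltngtP (N1 %/ m).+1 t; last 2 first.
- by move: j1; rewrite ltnS leqNgt ltn_divLR// mulnC Nt.
- rewrite (sol4E N10 N20 N30 N40 E1 E2 E3 E4) (H0 _ _ _ _ N1) ?orbT//.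
  + by rewrite E1 jE.
  + rewrite -(ltn_pmul2r N10) -mulnA E1 [m * _]mulnCA ltn_pmul2l//.
  + by rewrite -(leq_pmul2r N10) -mulnA E1 [m * _]mulnCA -mulnA [4 * _]mulnCA leq_pmul2l.
have [j tE] : exists j, t = N1 %/ m + j.
  by exists (t - N1 %/ m); rewrite subnKC// (leq_trans _ j0)// leqW.
have j2 : 1 < j by move: j0; rewrite tE -addn1 ltn_add2l.
have [e eE] : exists e, m * t = N1 + e by exists (m * t - N1); rewrite subnKC// ltnW.
(* Here [e = m * j - N1 %% m > m * j - m], and [j >= 2] makes [m] at most half of [m * j]. *)
have mj : m * j <= 2 * e.
  have : m * j + N1 %/ m * m = N1 %/ m * m + N1 %% m + e.
    by rewrite -divn_eq -eE tE; ring.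
  have := ltn_pmod N1 m0; have : 2 * m <= m * j by rewrite mulnC leq_mul.
  clear; lia.
have [/(H1 _ _ _ _ _ _ _ _ _ _ _ _ _ _ _ _ S (ltnW j2) tE) ->//|Q1] :=
  leqP (j * (x23 * x234)) Q.
pose k := x12 * x123 * x124 * x1234.
pose p := x13 * x14 * x134; pose q := x23 * x24 * x234.
have [z zE] : exists z, z * x34 = T3 + T4.
  (* [x34] divides [T1], [T2] and the left side of the equation. *)
  have : x34 %| T3 + T4.
    rewrite -(dvdn_addr (m := T1 + T2)) ?addnA -?E.
      by apply/dvdnP; exists (m * (k * p * q)); rewrite /k /p /q; ring.
    by apply/dvdnP; exists (N1 * q + N2 * p); rewrite /T1 /T2 /p /q; ring.
  by move=> /dvdnP[z ->]; exists z.
have [/(H2 _ _ _ _ _ _ _ _ _ _ _ _ _ _ _ _ S zE) ->|Q2] := leqP (k * z) Q.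
  by rewrite orbT.
pose c := x12 * x24 * x124 * x13 * x34 * x134 * x123 * x1234.
have [/(H3 _ _ _ _ _ _ _ _ _ _ _ _ _ _ _ S) ->|Q3] := leqP c Q.
  by rewrite !orbT.
exfalso.
(* After multiplication by [x34] the left side is at most [2 * e * w], and
   [e * w = T2 + T3 + T4 <= 3 * T2]. *)
have b1 : m * (j * (x23 * x234)) * x24 <= 6 * n * p.
  rewrite -(leq_pmul2r x340).
  rewrite (_ : m * (j * (x23 * x234)) * x24 * x34 = m * j * w); last by rewrite /w; ring.
  apply: (@leq_trans (2 * e * w)); first by rewrite leq_mul.
  have ew : e * w <= 3 * T2.
    have : T1 + e * w = T1 + T2 + T3 + T4 by rewrite T1E -mulnDl -eE.
    clear -T32 T43; lia.
  apply: (@leq_trans (6 * T2)); first by clear -ew; lia.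
  rewrite (_ : 6 * T2 = N2 * (6 * p * x34)); last by rewrite /T2 /p; ring.
  rewrite (_ : 6 * n * p * x34 = n * (6 * p * x34)); last by ring.
  by rewrite leq_mul.
have b2 : z * x34 <= 2 * n * (x12 * x14 * x24 * x124).
  rewrite zE; apply: (@leq_trans (2 * T3)); first by clear -T43; lia.
  by rewrite /T3 mulnA leq_mul// leq_mul.
(* This is the square of [b1] times [b2], times [k * c]. The powers of [x24] and [x34] cancel, and
   what remains falls short of [t ^ 3] by the factor [x123 * x1234]. *)
have b3 : m ^ 2 * ((j * (x23 * x234)) ^ 2 * (k * z) * c) <= 72 * n ^ 3 * t ^ 3.
  rewrite -(@leq_pmul2r (x24 ^ 2 * x34)) ?muln_gt0 ?expn_gt0 ?x240//.
  rewrite (_ : _ * (x24 ^ 2 * x34) =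
    (m * (j * (x23 * x234)) * x24) ^ 2 * (z * x34) * (k * c)); last by ring.
  apply: (@leq_trans ((6 * n * p) ^ 2 * (2 * n * (x12 * x14 * x24 * x124)) * (k * c))).
    by rewrite leq_mul// leq_mul// leq_exp2r.
  rewrite (_ : (6 * n * p) ^ 2 * _ * _ = 72 * n ^ 3 * (x24 ^ 2 * x34) *
    (x13 ^ 3 * x14 ^ 3 * x134 ^ 3 * x12 ^ 3 * x124 ^ 3 * x123 ^ 2 * x1234 ^ 2));
    last by rewrite /p /k /c; ring.
  rewrite (_ : 72 * n ^ 3 * t ^ 3 * (x24 ^ 2 * x34) =
    72 * n ^ 3 * (x24 ^ 2 * x34) * (x13 ^ 3 * x14 ^ 3 * x134 ^ 3 * x12 ^ 3 *
      x124 ^ 3 * x123 ^ 2 * x1234 ^ 2 * (x123 * x1234))); last by rewrite /t; ring.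
  by rewrite leq_mul// leq_pmulr//; posn.
(* From [m * t <= 4 * n], with [72 * 4 ^ 3 = 4608]. *)
have b4 : m ^ 5 * ((j * (x23 * x234)) ^ 2 * (k * z) * c) <= 4608 * n ^ 6.
  rewrite (_ : m ^ 5 * _ = m ^ 3 * (m ^ 2 * ((j * (x23 * x234)) ^ 2 * (k * z) * c)));
    last by ring.
  apply: (@leq_trans (m ^ 3 * (72 * n ^ 3 * t ^ 3))); first by rewrite leq_mul.
  rewrite (_ : m ^ 3 * (72 * n ^ 3 * t ^ 3) = 72 * n ^ 3 * (m * t) ^ 3); last by ring.
  rewrite (_ : 4608 * n ^ 6 = 72 * n ^ 3 * (4 * n) ^ 3); last by ring.
  by rewrite leq_mul// leq_exp2r// (leq_trans tN)// leq_mul.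
have : m ^ 5 * Q.+1 ^ 4 <= m ^ 5 * Q ^ 4.
  apply: leq_trans (leq_trans b4 HQ); rewrite leq_mul//.
  rewrite (_ : Q.+1 ^ 4 = Q.+1 ^ 2 * Q.+1 * Q.+1); last by ring.
  by rewrite leq_mul// leq_mul// leq_exp2r.
by rewrite leq_pmul2l ?expn_gt0 ?m0// leq_exp2r// ltnn.
Qed.

(** * From the count of representations to integer equations *)

Import Order.TTheory GRing.Theory Num.Theory.

Lemma egyptian_count_le (k m n : nat) (L : seq (seq nat)) :
  (forall a, unit_fraction_reps k m n a -> tval a \in L) ->
  egyptian_count k m n <= size L.
Proof.
move=> H; rewrite /egyptian_count.
rewrite -(size_map (@tval k nat)); apply: uniq_leq_size.
  by rewrite map_inj_uniq; [exact: fset_uniq|exact: val_inj].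
move=> s /mapP[a aS ->]; apply: H.
by move: aS; rewrite in_fset_set ?inE//; exact: finite_unit_fraction_reps.
Qed.

Lemma egyptian_equation4 (m n a1 a2 a3 a4 : nat) :
  0 < n -> 0 < a1 -> 0 < a2 -> 0 < a3 -> 0 < a4 ->
  (m%:R / n%:R = \sum_(x <- [:: a1; a2; a3; a4]) x%:R^-1 :> rat)%R ->
  m * a1 * a2 * a3 * a4 =
    n * (a2 * a3 * a4 + a1 * a3 * a4 + a1 * a2 * a4 + a1 * a2 * a3).
Proof.
move=> n0 a10 a20 a30 a40; rewrite !big_cons big_nil addr0 => E.
apply/eqP; rewrite -(eqr_nat rat) !(natrM, natrD); apply/eqP.
have nz (x : nat) : 0 < x -> (x%:R != 0 :> rat)%R by rewrite pnatr_eq0 lt0n.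
have -> : (m%:R = n%:R * (a1%:R^-1 + (a2%:R^-1 + (a3%:R^-1 + a4%:R^-1))) :> rat)%R.
  by rewrite -E mulrCA mulfV ?mulr1// nz.
by field; rewrite !nz.
Qed.

(** Each denominator is the smallest of those left, hence at most their number divided by the
    remainder, whose numerator is at least 1. This gives [4 * n], [12 * n ^ 2] and [96 * n ^ 4] in
    turn; finally [a4] divides [n * a1 * a2 * a3]. *)
Lemma denominators_le (m n a1 a2 a3 a4 : nat) :
  0 < m -> 0 < n -> 0 < a1 -> a1 <= a2 -> a2 <= a3 -> a3 <= a4 ->
  m * a1 * a2 * a3 * a4 =
    n * (a2 * a3 * a4 + a1 * a3 * a4 + a1 * a2 * a4 + a1 * a2 * a3) ->
  m * a1 <= 4 * n /\ a4 <= 4608 * n ^ 8.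
Proof.
move=> m0 n0 a10 a12 a23 a34 E.
have a20 : 0 < a2 := leq_trans a10 a12.
have a30 : 0 < a3 := leq_trans a20 a23.
have a40 : 0 < a4 := leq_trans a30 a34.
have ma : m * a1 <= 4 * n.
  rewrite -(@leq_pmul2r (a2 * a3 * a4)) ?muln_gt0 ?a20 ?a30// !mulnA E.
  rewrite (_ : 4 * n * a2 * a3 * a4 = n * (a2 * a3 * a4 + a2 * a3 * a4
    + a2 * a3 * a4 + a2 * a3 * a4)); last by ring.
  by apply: leq_mul => //; do 3? apply: leq_add => //; do 2? apply: leq_mul.
split=> //.
have a1n : a1 <= 4 * n by apply: leq_trans ma; rewrite leq_pmull.
(* [u], [v] and [w] are the numerators of the successive remainders. *)
have [u uE] : exists u, m * a1 = n + u.
  exists (m * a1 - n); rewrite subnKC//.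
  rewrite -(@leq_pmul2r (a2 * a3 * a4)) ?muln_gt0 ?a20 ?a30// !mulnA E.
  by rewrite -!mulnA leq_mul// -!addnA mulnA leq_addr.
have E2 : u * a2 * a3 * a4 = n * a1 * (a3 * a4 + a2 * a4 + a2 * a3).
  apply: (@addnI (n * a2 * a3 * a4)); rewrite -!mulnDl -uE E; ring.
have ua : u * a2 <= 3 * (n * a1).
  rewrite -(@leq_pmul2r (a3 * a4)) ?muln_gt0 ?a30// !mulnA E2.
  rewrite (_ : 3 * n * a1 * a3 * a4 = n * a1 * (a3 * a4 + a3 * a4 + a3 * a4));
    last by ring.
  by rewrite leq_mul// !leq_add// leq_mul.
have u0 : 0 < u.
  by move: E2; case: (u) => //; rewrite !mul0n => /esym/eqP; rewrite !(muln_eq0, addn_eq0); lia.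
have a2n : a2 <= 12 * n ^ 2.
  apply: (@leq_trans (u * a2)); first by rewrite leq_pmull.
  apply: leq_trans ua _; rewrite (_ : 12 * n ^ 2 = 3 * (n * (4 * n))); last by ring.
  by rewrite !leq_mul.
have [v vE] : exists v, u * a2 = n * a1 + v.
  exists (u * a2 - n * a1); rewrite subnKC//.
  rewrite -(@leq_pmul2r (a3 * a4)) ?muln_gt0 ?a30// !mulnA E2.
  by rewrite -!mulnA leq_mul// leq_mul// -!addnA leq_addr.
have E3 : v * a3 * a4 = n * a1 * a2 * (a4 + a3).
  apply: (@addnI (n * a1 * a3 * a4)); rewrite -!mulnDl -vE E2; ring.
have v0 : 0 < v.
  by move: E3; case: (v) => //; rewrite !mul0n => /esym/eqP; rewrite !(muln_eq0, addn_eq0); lia.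
have va : v * a3 <= 2 * (n * a1 * a2).
  rewrite -(@leq_pmul2r a4)// E3.
  rewrite (_ : 2 * _ * a4 = n * a1 * a2 * (a4 + a4)); last by ring.
  by rewrite leq_mul// leq_add.
have a3n : a3 <= 96 * n ^ 4.
  apply: (@leq_trans (v * a3)); first by rewrite leq_pmull.
  apply: leq_trans va _.
  rewrite (_ : 96 * n ^ 4 = 2 * (n * (4 * n) * (12 * n ^ 2))); last by ring.
  by rewrite !leq_mul.
have [w wE] : exists w, v * a3 = n * a1 * a2 + w.
  exists (v * a3 - n * a1 * a2); rewrite subnKC//.
  by rewrite -(@leq_pmul2r a4)// E3 leq_mul// leq_addr.
have E4 : w * a4 = n * a1 * a2 * a3.
  apply: (@addnI (n * a1 * a2 * a4)); rewrite -!mulnDl -wE E3; ring.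
have w0 : 0 < w.
  by move: E4; case: (w) => //; rewrite !mul0n => /esym/eqP; rewrite !(muln_eq0, addn_eq0); lia.
apply: (@leq_trans (w * a4)); first by rewrite leq_pmull.
rewrite E4 (_ : 4608 * n ^ 8 = n * (4 * n) * (12 * n ^ 2) * (96 * n ^ 4)); last by ring.
by rewrite !leq_mul.
Qed.

Lemma unit_fraction_reps4 (m n : nat) (a : 4.-tuple nat) : 0 < n ->
  unit_fraction_reps 4 m n a -> exists a1 a2 a3 a4,
  tval a = [:: a1; a2; a3; a4] /\
  [/\ 0 < a1, a1 <= a2, a2 <= a3, a3 <= a4
  & m * a1 * a2 * a3 * a4 =
    n * (a2 * a3 * a4 + a1 * a3 * a4 + a1 * a2 * a4 + a1 * a2 * a3)].
Proof.
move=> n0; rewrite /unit_fraction_reps /=.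
rewrite -(big_tuple _ _ a predT (fun x : nat => (x%:R^-1 : rat)%R)).
case: a => -[|a1 [|a2 [|a3 [|a4 [|//]]]]] //= _ [/and5P[a10 a20 a30 a40 _]].
move=> /and4P[a12 a23 a34 _] E; exists a1, a2, a3, a4; do 2 split=> //.
exact: egyptian_equation4.
Qed.

Lemma egyptian_count4_eq0 (m n : nat) : 0 < n -> 4 * n < m ->
  egyptian_count 4 m n = 0.
Proof.
move=> n0 nm; apply/eqP; rewrite -leqn0; apply: (@egyptian_count_le _ _ _ [::]).
move=> a /(unit_fraction_reps4 n0)[a1 [a2 [a3 [a4 [_ [a10 a12 a23 a34 E]]]]]].
have m0 : 0 < m by lia.
have [ma _] := denominators_le m0 n0 a10 a12 a23 a34 E.
by move: (leq_trans nm (leq_trans (leq_pmulr m a10) ma)); rewrite ltnn.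
Qed.

Lemma egyptian_count4_le (m n D Q Q' : nat) : 0 < m -> 0 < n -> m <= 4 * n ->
  few_divisors (4608 * n ^ 8) D ->
  4608 * n ^ 6 <= m ^ 5 * Q ^ 4 ->
  (2304 * n ^ 6 <= m ^ 3 * Q' ^ 5) || (144 * n ^ 4 <= m ^ 2 * Q' ^ 3) ->
  egyptian_count 4 m n <= 3 * (Q * D ^ 13) + D * (5 * (Q' * D ^ 5)).
Proof.
move=> m0 n0 mn HD HQ HQ'; set A := 4608 * n ^ 8 in HD.
have nA : 4 * n <= A by rewrite leq_mul// -{1}(expn1 n) leq_pexp2l.
have n2A : 4 * n ^ 2 <= A by rewrite leq_mul// leq_pexp2l.
have A1 : 1 < A by apply: leq_trans nA; rewrite (@leq_mul 2 1).
have [|L [sL HL]] := cover4 A1 m0 n0 (leq_trans mn nA) _ n2A HD HQ HQ'.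
  by apply: leq_trans nA; rewrite leq_pmull.
apply: leq_trans sL; apply: egyptian_count_le.
move=> a /(unit_fraction_reps4 n0)[a1 [a2 [a3 [a4 [-> [a10 a12 a23 a34 E]]]]]].
have [_ a4A] := denominators_le m0 n0 a10 a12 a23 a34 E.
exact: HL.
Qed.

(** * The divisor bound and real exponents *)

Local Open Scope ring_scope.

Lemma natr_expR (R : realType) (n : nat) : (0 < n)%N -> n%:R = expR (ln n%:R) :> R.
Proof. by move=> n0; rewrite lnK// posrE ltr0n. Qed.

Lemma powR_expR (R : realType) (n : nat) (x : R) : (0 < n)%N ->
  n%:R `^ x = expR (x * ln n%:R).
Proof. by move=> n0; rewrite /powR gt_eqF// ltr0n. Qed.

(** [(p ^ a) ^ d = exp (a d ln p)] is at least [1 + a d ln 2], and the constant [K] satisfies both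
    [K >= 1] and [K d ln 2 >= 1]. *)
Lemma succn_le_pfactor_powR (R : realType) (d : R) (p a : nat) :
  (1 < p)%N -> 0 < d ->
  a.+1%:R <= Num.max 1 (d * ln 2)^-1 * (p ^ a)%:R `^ d :> R.
Proof.
move=> p1 d0; set K := Num.max _ _.
have l2 : 0 < ln 2 :> R by rewrite ln_gt0// ltr1n.
have dl : 0 < d * ln 2 by rewrite mulr_gt0.
have K1 : 1 <= K by rewrite /K le_max lexx.
have Kd : 1 <= K * (d * ln 2).
  by rewrite -ler_pdivrMr// mul1r /K le_max lexx orbT.
have le : 1 + a%:R * (d * ln 2) <= (p ^ a)%:R `^ d :> R.
  rewrite powR_expR; last by rewrite expn_gt0 ltnW.
  apply: le_trans (expR_ge1Dx _) _; rewrite ler_expR natrX lnXn ?ltr0n ?(ltnW p1)//.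
  rewrite -[ln _ *+ a]mulr_natl [leRHS]mulrCA ler_wpM2l// ler_wpM2l ?(ltW d0)//.
  by rewrite ler_ln ?posrE ?ltr0n ?(ltnW p1)// ler_nat.
apply: le_trans (ler_wpM2l (le_trans ler01 K1) le).
rewrite -natr1 mulrDr mulr1 addrC lerD// mulrCA.
by rewrite ler_peMr.
Qed.

(** A prime [p >= 2 ^ (1 / d)] costs nothing, since [p ^ (a d) >= 2 ^ a >= a + 1]; each smaller
    prime costs a factor [K]. The induction strips off the full power of the least prime factor. *)
Lemma divisor_bound (R : realType) (d : R) : 0 < d ->
  exists C : R, 1 <= C /\
    forall n, (0 < n)%N -> (size (divisors n))%:R <= C * n%:R `^ d.
Proof.
move=> d0; pose P := (Num.truncn (2 `^ d^-1 : R)).+1.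
have large p a : (P <= p)%N -> a.+1%:R <= (p ^ a)%:R `^ d :> R.
  move=> Pp; have p0 : (0 < p)%N by exact: leq_trans Pp.
  have p2 : 2 <= p%:R `^ d :> R.
    have lt : 2 `^ d^-1 <= p%:R :> R.
      by apply/ltW/(lt_le_trans (truncnS_gt _)); rewrite ler_nat.
    have := @ge0_ler_powR R d (ltW d0) (2 `^ d^-1) p%:R.
    rewrite !nnegrE powR_ge0 ler0n => /(_ isT isT lt).
    by rewrite -powRrM mulVf ?gt_eqF// powRr1.
  rewrite natrX -powR_mulrn// powRAC powR_mulrn ?powR_ge0//.
  apply: (@le_trans _ _ ((2 : R) ^+ a)); last by rewrite lerXn2r ?nnegrE ?powR_ge0.
  by rewrite -natrX ler_nat ltn_expl.
set K : R := Num.max 1 (d * ln 2)^-1.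
have K1 : 1 <= K by rewrite /K le_max lexx.
have K0 : 0 <= K := le_trans ler01 K1.
(* The number of small primes dividing [n], which is at most [P]. *)
pose c n := #|[set q : 'I_P | prime q && (q %| n)%N]|.
exists (K ^+ P); split; first exact: exprn_ege1.
suff H n : (0 < n)%N -> (size (divisors n))%:R <= K ^+ c n * n%:R `^ d.
  move=> n n0; apply: le_trans (H _ n0) _; rewrite ler_wpM2r ?powR_ge0//.
  by rewrite ler_weXn2l// (leq_trans (max_card _))// card_ord.
elim/ltn_ind: n => n IH n0; have [n1|n1] := leqP n 1.
  have -> : n = 1%N by apply/eqP; rewrite eqn_leq n1 n0.
  by rewrite powR1 mulr1 exprn_ege1.
pose p := pdiv n; pose a := logn p n; pose m := (n`_p^')%N.
have pp : prime p by exact: pdiv_prime.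
have pn : (p %| n)%N by exact: pdiv_dvd.
have nE : n = (p ^ a * m)%N by rewrite -p_part partnC.
have m0 : (0 < m)%N by exact: part_gt0.
have a0 : (0 < a)%N by rewrite /a logn_gt0 mem_primes pp n0.
have mn : (m < n)%N.
  by rewrite [X in (_ < X)%N]nE ltn_Pmull// -(exp1n a) ltn_exp2r// prime_gt1.
have npm : ~~ (p %| m)%N by rewrite -p'natE// part_pnat.
have cpm : coprime p m by rewrite prime_coprime.
have sz : (size (divisors n) <= a.+1 * size (divisors m))%N.
  by rewrite {1}nE divisors_pfactor_mul.
have nd : n%:R `^ d = (p ^ a)%:R `^ d * m%:R `^ d :> R.
  by rewrite {1}nE natrM powRM.
have sub : [set q : 'I_P | prime q && (q %| m)%N] \subset
    [set q : 'I_P | prime q && (q %| n)%N].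
  apply/fintype.subsetP => q; rewrite !inE => /andP[-> qm].
  by rewrite nE dvdn_mull.
apply: (@le_trans _ _ (a.+1%:R * (K ^+ c m * m%:R `^ d))).
  apply: (@le_trans _ _ (a.+1 * size (divisors m))%:R); first by rewrite ler_nat.
  by rewrite natrM ler_wpM2l// IH.
rewrite nd; have [pP|Pp] := ltnP p P; last first.
  rewrite mulrCA mulrA [leRHS]mulrA ler_wpM2r ?powR_ge0// mulrC [leRHS]mulrC.
  apply: ler_pM; rewrite ?exprn_ge0//; first exact: large.
  by rewrite ler_weXn2l// subset_leq_card.
have cc : (c m < c n)%N.
  apply: proper_card; rewrite properE sub /=; apply/fintype.subsetPn.
  by exists (Ordinal pP); rewrite !inE /= pp ?pn.
apply: (@le_trans _ _ (K * (p ^ a)%:R `^ d * (K ^+ c m * m%:R `^ d))).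
  rewrite ler_wpM2r ?mulr_ge0 ?exprn_ge0 ?powR_ge0//.
  by apply: succn_le_pfactor_powR => //; exact: prime_gt1.
rewrite mulrACA -exprS ler_wpM2r ?mulr_ge0 ?powR_ge0//.
by rewrite ler_weXn2l.
Qed.

(** Rounding up to an integer parameter costs at most a factor 2; this needs [r >= 1]. *)
Lemma truncn_succ_le (R : realType) (r : R) : 1 <= r ->
  r <= (Num.truncn r).+1%:R <= 2 * r.
Proof.
move=> r1; rewrite ltW ?truncnS_gt//= -natr1 mulr_natl mulr2n lerD//.
by rewrite truncn_le (le_trans ler01).
Qed.

(* With [e = (c + i a - j b) / k], [expR e] is the [k]-th root of
   [expR c * n ^ i / m ^ j]. *)
Lemma natr_root_le (R : realType) (c i j k m n Q : nat) : (0 < c)%N ->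
  (0 < m)%N -> (0 < n)%N -> (0 < k)%N ->
  expR ((ln c%:R + i%:R * ln n%:R - j%:R * ln m%:R) / k%:R) <= Q%:R :> R ->
  (c * n ^ i <= m ^ j * Q ^ k)%N.
Proof.
move=> c0 m0 n0 k0 le; rewrite -(ler_nat R) !natrM !natrX.
have k0' : k%:R != 0 :> R by rewrite pnatr_eq0 -lt0n.
apply: (@le_trans _ _ (m%:R ^+ j *
    expR ((ln c%:R + i%:R * ln n%:R - j%:R * ln m%:R) / k%:R) ^+ k)).
  rewrite -expRM_natl [k%:R * _]mulrC divfK// (natr_expR R c0) (natr_expR R n0)
    (natr_expR R m0) -!expRM_natl -!expRD !expRK.
  by rewrite le_eqVlt; apply/orP; left; apply/eqP; congr expR; ring.
by rewrite ler_wpM2l ?exprn_ge0// lerXn2r ?nnegrE ?expR_ge0// (le_trans (expR_ge0 _) le).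
Qed.

Lemma ln_ge_mul (R : realType) (k c N : nat) : (0 < c)%N -> (c ^ k <= N)%N ->
  k%:R * ln c%:R <= ln N%:R :> R.
Proof.
move=> c0 cN; have c0' : 0 < c%:R :> R by rewrite ltr0n.
rewrite mulr_natl -lnXn// -natrX ler_ln ?posrE ?ltr0n ?ler_nat ?expn_gt0 ?c0//.
by rewrite (leq_trans _ cN)// expn_gt0 c0.
Qed.

Lemma egyptian_count4_le_expR (R : realType) (eps : R) : 0 < eps ->
  exists C : R, 0 < C /\ forall m n, (0 < m)%N -> (0 < n)%N -> (m <= 4 * n)%N ->
  forall r s : R, r = (6 * ln n%:R - 5 * ln m%:R) / 4 ->
    s = (6 * ln n%:R - 3 * ln m%:R) / 5 \/ s = (4 * ln n%:R - 2 * ln m%:R) / 3 ->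
    (egyptian_count 4 m n)%:R <= C * n%:R `^ eps * (expR r + expR s).
Proof.
(* At most 13 divisor factors occur, each for numbers up to [(4608 * n ^ 8) ^ 100], which has degree
   800 in [n]. *)
move=> e0; pose d' := eps / 13; pose d := d' / 800.
have d'0 : 0 < d' by rewrite /d'; lra.
have d0 : 0 < d by rewrite /d; lra.
have [C0 [C1 HC]] := divisor_bound d0.
have C00 : 0 < C0 := lt_le_trans ltr01 C1.
(* The constants become variables, so that large numerals are not unfolded. *)
have [N NE] : exists N, N = 4608%N by exists 4608%N.
have [N1 N1E] : exists N, N = 2304%N by exists 2304%N.
have [N2 N2E] : exists N, N = 144%N by exists 144%N.
have N10 : (0 < N1)%N by rewrite N1E.
have N20 : (0 < N2)%N by rewrite N2E.
have N0 : (0 < N)%N by rewrite NE.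
pose W : R := (N ^ 100)%:R `^ d.
have W1 : 1 <= W.
  have N100 : (0 < N ^ 100)%N by rewrite expn_gt0 N0.
  rewrite /W powR_expR// -[leLHS]expR0 ler_expR; apply: mulr_ge0; first exact: ltW.
  apply: ln_ge0.
  by rewrite ler1n.
have W0 : 0 <= W := le_trans ler01 W1.
pose K : R := expR (ln N%:R + ln N1%:R + ln N2%:R).
have l1 : 0 <= ln N%:R :> R by rewrite ln_ge0// ler1n.
have l2 : 0 <= ln N1%:R :> R by rewrite ln_ge0// ler1n.
have l3 : 0 <= ln N2%:R :> R by rewrite ln_ge0// ler1n.
(* Together with [m <= 4 * n], these three inequalities make the exponents [x] and [y] below
   nonnegative, so that their exponentials can be rounded up. *)
have l46 : 5%:R * ln 4%:R <= ln N%:R :> R by rewrite ln_ge_mul// NE.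
have l23 : 3%:R * ln 4%:R <= ln N1%:R :> R by rewrite ln_ge_mul// N1E.
have l14 : 2%:R * ln 4%:R <= ln N2%:R :> R by rewrite ln_ge_mul// N2E.
exists (10 * K * (C0 * W) ^+ 13); split.
  apply: mulr_gt0; first by apply: mulr_gt0 => //; exact: expR_gt0.
  by apply: exprn_gt0; apply: mulr_gt0 => //; exact: lt_le_trans W1.
move=> m n m0 n0 mn r s rE sE.
set a := ln n%:R in rE sE; set b := ln m%:R in rE sE.
have a0 : 0 <= a by rewrite ln_ge0// ler1n.
have b0 : 0 <= b by rewrite ln_ge0// ler1n.
have ba : b <= ln 4 + a.
  by rewrite -lnM ?posrE ?ltr0n// ler_ln ?posrE ?mulr_gt0 ?ltr0n// -natrM ler_nat.
pose V : R := C0 * W * n%:R `^ d'.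
have n1 : 1 <= n%:R `^ d'.
  by rewrite powR_expR// -[leLHS]expR0 ler_expR; apply: mulr_ge0 => //; exact: ltW.
have V1 : 1 <= V.
  by rewrite /V; do 2! apply: mulr_ege1 => //.
have VE : C0 * ((N * n ^ 8) ^ 100)%:R `^ d = V.
  rewrite expnMn natrM powRM// -/W mulrA -expnM natrX -powR_mulrn// -powRrM.
  congr (_ * _ `^ _); rewrite natrM /d; clear; lra.
pose D := Num.truncn V; have V0 : 0 <= V := le_trans ler01 V1.
have DV : D%:R <= V by rewrite truncn_le.
have D1 : (0 < D)%N by rewrite truncn_gt0.
have HD : few_divisors (4608 * n ^ 8) D.
  rewrite -NE.
  (* [divisors 0] is [[:: 1]], so [D >= 1] is enough there. *)
  move=> [|y] yA; first by [].
  rewrite truncn_ge_nat// -VE; apply: le_trans (HC _ _) _ => //.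
  rewrite ler_wpM2l ?(ltW C00)// ge0_ler_powR ?nnegrE ?(ltW d0)//.
  by rewrite ler_nat.
pose x : R := (ln N%:R + 6%:R * a - 5%:R * b) / 4%:R.
have x0 : 0 <= x by rewrite /x divr_ge0//; clear -l46 ba a0; lra.
have /andP[xQ Qx] : expR x <= (Num.truncn (expR x)).+1%:R <= 2 * expR x.
  by apply: truncn_succ_le; rewrite -[leLHS]expR0 ler_expR.
set Q := (Num.truncn (expR x)).+1 in xQ Qx.
have HQ : (4608 * n ^ 6 <= m ^ 5 * Q ^ 4)%N by rewrite -NE; apply: (@natr_root_le R).
have xK : expR x <= K * expR r.
  by rewrite -expRD ler_expR /x rE; clear -l1 l2 l3; lra.
have [Q' [HQ' Qy]] : exists Q', (2304 * n ^ 6 <= m ^ 3 * Q' ^ 5)%N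
    || (144 * n ^ 4 <= m ^ 2 * Q' ^ 3)%N /\ Q'%:R <= 2 * (K * expR s).
  case: sE => sE.
    pose y : R := (ln N1%:R + 6%:R * a - 3%:R * b) / 5%:R.
    have y0 : 0 <= y by rewrite /y divr_ge0//; clear -l23 ba a0; lra.
    have /andP[yQ Qy] : expR y <= (Num.truncn (expR y)).+1%:R <= 2 * expR y.
      by apply: truncn_succ_le; rewrite -[leLHS]expR0 ler_expR.
    exists (Num.truncn (expR y)).+1; split.
      by apply/orP; left; rewrite -N1E; apply: (@natr_root_le R).
    apply: le_trans Qy _; rewrite ler_wpM2l// -expRD ler_expR /y sE; clear -l1 l2 l3; lra.
  pose y : R := (ln N2%:R + 4%:R * a - 2%:R * b) / 3%:R.
  have y0 : 0 <= y by rewrite /y divr_ge0//; clear -l14 ba a0; lra.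
  have /andP[yQ Qy] : expR y <= (Num.truncn (expR y)).+1%:R <= 2 * expR y.
    by apply: truncn_succ_le; rewrite -[leLHS]expR0 ler_expR.
  exists (Num.truncn (expR y)).+1; split.
    by apply/orP; right; rewrite -N2E; apply: (@natr_root_le R).
  apply: le_trans Qy _; rewrite ler_wpM2l// -expRD ler_expR /y sE; clear -l1 l2 l3; lra.
have := egyptian_count4_le m0 n0 mn HD HQ HQ'.
(* Since [D >= 1], the factor [D ^ 6] of the second term is at most [D ^ 13]. *)
have D13 : (3 * (Q * D ^ 13) + D * (5 * (Q' * D ^ 5)) <= 5 * D ^ 13 * (Q + Q'))%N.
  rewrite mulnDr leq_add//.
    by rewrite mulnAC mulnA leq_mul// leq_mul.
  rewrite (_ : (D * (5 * (Q' * D ^ 5)) = 5 * D ^ 6 * Q')%N); last by ring.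
  by rewrite leq_mul// leq_mul// leq_pexp2l.
move=> /leq_trans/(_ D13); rewrite -(ler_nat R) => le; apply: le_trans le _.
have VV : V ^+ 13 = (C0 * W) ^+ 13 * n%:R `^ eps.
  rewrite /V exprMn -[X in _ * X = _]powR_mulrn ?powR_ge0// -powRrM; congr (_ * _ `^ _).
  by rewrite /d'; clear; lra.
rewrite natrM natrD natrM natrX.
apply: (@le_trans _ _ (5 * V ^+ 13 * (2 * (K * expR r) + 2 * (K * expR s)))).
  apply: ler_pM; rewrite ?mulr_ge0 ?exprn_ge0 ?addr_ge0//.
    by rewrite ler_wpM2l// lerXn2r ?nnegrE.
  by rewrite lerD// (le_trans Qx)// ler_wpM2l.
by rewrite VV le_eqVlt; apply/orP; left; apply/eqP; ring.
Qed.

(** * Comparison of the exponents *)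

Unset Implicit Arguments.
Set Strict Implicit.

Theorem corollary1 (R : realType) (eps : R) (heps : 0 < eps) :
  exists C : R, 0 < C /\
    forall m n : nat, (0 < m)%N -> (0 < n)%N ->
      (egyptian_count 4 m n)%:R <=
        C * n%:R `^ eps *
        Num.min (n%:R `^ (3 / 2) / m%:R `^ (3 / 4))
       (Num.min (n%:R `^ (8 / 5) / m%:R)
       (Num.min (n%:R `^ (4 / 3) / m%:R `^ (2 / 3)
                 + n%:R `^ (28 / 17) / m%:R `^ (8 / 5))
                ((n%:R / m%:R) `^ (5 / 3)
                 + n%:R `^ (4 / 3) / m%:R `^ (2 / 3)))).
Proof.
have [C [C0 HC]] := egyptian_count4_le_expR heps.
(* The 2 counts the two exponentials, and [expR (ln 4)] absorbs the loss when [m] lies between [n]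
   and [4 * n]. *)
exists (C * (2 * expR (ln 4))); split; first by rewrite !mulr_gt0 ?expR_gt0.
move=> m n m0 n0.
have powE (x y : R) : n%:R `^ x / m%:R `^ y = expR (x * ln n%:R - y * ln m%:R).
  by rewrite !powR_expR// expRB.
have -> : (n%:R / m%:R) `^ (5 / 3) = expR (5 / 3 * ln n%:R - 5 / 3 * ln m%:R) :> R.
  by rewrite /powR gt_eqF ?divr_gt0 ?ltr0n// ln_div ?posrE ?ltr0n// mulrBr.
have -> : n%:R `^ (8 / 5) / m%:R = expR (8 / 5 * ln n%:R - ln m%:R) :> R.
  by rewrite expRB -natr_expR// powR_expR.
rewrite !powE.
set T := Num.min _ _.
have T0 : 0 <= T by rewrite !le_min !addr_ge0 ?expR_ge0.
have [mn|mn] := leqP m (4 * n); last first.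
  by rewrite egyptian_count4_eq0// !mulr_ge0 ?powR_ge0 ?expR_ge0// ltW.
have {HC} := HC m n m0 n0 mn; set a := ln n%:R in T T0 *; set b := ln m%:R in T T0 *.
have a0 : 0 <= a by rewrite ln_ge0// ler1n.
have b0 : 0 <= b by rewrite ln_ge0// ler1n.
have l4 : 0 <= ln 4 :> R by rewrite ln_ge0// ler1n.
have ba : b <= ln 4 + a.
  by rewrite -lnM ?posrE ?ltr0n// ler_ln ?posrE ?mulr_gt0 ?ltr0n// -natrM ler_nat.
(* The logarithms of [n ^ (3/2) / m ^ (5/4)], [(n ^ 2 / m) ^ (3/5)] and [(n ^ 2 / m) ^ (2/3)]. *)
pose r := (6 * a - 5 * b) / 4.
pose s1 := (6 * a - 3 * b) / 5; pose s2 := (4 * a - 2 * b) / 3.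
move=> HC; have H1 := HC r s1 erefl (or_introl erefl).
have {HC} H2 := HC r s2 erefl (or_intror erefl).
have Cn0 : 0 <= C * n%:R `^ eps by rewrite mulr_ge0 ?powR_ge0// ltW.
have from (s B : R) : (egyptian_count 4 m n)%:R <= C * n%:R `^ eps * (expR r + expR s) ->
    expR r <= expR (ln 4) * B -> expR s <= expR (ln 4) * B ->
    (egyptian_count 4 m n)%:R <= C * (2 * expR (ln 4)) * n%:R `^ eps * B.
  move=> le rB sB; apply: le_trans le _.
  rewrite (_ : C * (2 * expR (ln 4)) * n%:R `^ eps * B =
    C * n%:R `^ eps * (expR (ln 4) * B + expR (ln 4) * B)); last by ring.
  by rewrite ler_wpM2l// lerD.
have expl (x y : R) : x <= ln 4 + y -> expR x <= expR (ln 4) * expR y.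
  by move=> xy; rewrite -expRD ler_expR.
have expDl (x y z : R) : x <= ln 4 + y \/ x <= ln 4 + z ->
    expR x <= expR (ln 4) * (expR y + expR z).
  rewrite mulrDr; move=> [/expl xy|/expl xz].
    by apply: le_trans xy _; rewrite lerDl mulr_ge0 ?expR_ge0.
  by apply: le_trans xz _; rewrite lerDr mulr_ge0 ?expR_ge0.
have minP (x y : R) : (egyptian_count 4 m n)%:R <= C * (2 * expR (ln 4)) * n%:R `^ eps * x ->
    (egyptian_count 4 m n)%:R <= C * (2 * expR (ln 4)) * n%:R `^ eps * y ->
    (egyptian_count 4 m n)%:R <= C * (2 * expR (ln 4)) * n%:R `^ eps * Num.min x y.
  by case: (leP x y).
clear -l4 a0 b0 ba H1 H2 from expl expDl minP; rewrite /T.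
apply: (minP).
  by apply: (from _ _ H2); apply: expl; rewrite /r /s2; clear -l4 a0 b0 ba; lra.
(* The bound [n ^ (8/5) / m] takes [s1]: for [m] near [n] the exponent [s2] would be too large. *)
apply: (minP).
  by apply: (from _ _ H1); apply: expl; rewrite /r /s1; clear -l4 a0 b0 ba; lra.
apply: (minP).
  apply: (from _ _ H2); apply: expDl; rewrite /r /s2; clear -l4 a0 b0 ba.
    (* For [7 * b >= 2 * a] the first term dominates [expR r], for [119 * b <= 50 * a] the second;
       the split at [5 * b = 2 * a] lies between. *)
    by have [le|ge] := leP (5 * b) (2 * a); [right|left]; lra.
  by left; lra.
apply: (from _ _ H2); apply: expDl; rewrite /r /s2; clear -l4 a0 b0 ba.
  (* Here [r <= 5 / 3 * (a - b)] holds exactly when [5 * b <= 2 * a]. *)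
  by have [le|ge] := leP (5 * b) (2 * a); [left|right]; lra.
by right; lra.
Qed.
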